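(* For a graph $G$, the following conditions are equivalent: (i) $G$ is a prime pre-median graph; (ii) $G$ is a $2$--connected pre-median graph and each square of $G$ is included in an induced $W_4$ or an induced $M_4$; (iii) $G$ is a $2$--connected pre-median graph and its triangle complex (and hence its clique complex) is simply connected; (iv) $G$ is a $2$--connected locally weakly modular graph not containing induced $K_{2,3}$ and $W_4^-$, and its triangle complex is simply connected.
   Context: Graphs are simple, undirected, connected, possibly infinite; $d$ is graph distance, $I(u,v)=\{x:d(u,x)+d(x,v)=d(u,v)\}$. Weakly modular: for every vertex $u$, (TC) for $v,w$ with $1=d(v,w)<d(u,v)=d(u,w)$ there is a common neighbor $x$ of $v,w$ with $d(u,x)=d(u,v)-1$, and (QC) for $v,w,z$ with $d(v,z)=d(w,z)=1$, $2=d(v,w)\le d(u,v)=d(u,w)=d(u,z)-1$ there is a common neighbor $x$ of $v,w$ with $d(u,x)=d(u,v)-1$. Locally weakly modular: for every $u$, (LTC) for adjacent $v,w$ with $d(u,v)=d(u,w)=2$ there is a common neighbor of $u,v,w$, and (LQC) for $v,w,z$ with $z\sim v,w$, $d(v,w)=d(u,v)=d(u,w)=d(u,z)-1=2$ there is a common neighbor of $u,v,w$. A square is an induced $4$--cycle. $W_4$ is a $4$--cycle plus a vertex adjacent to all its vertices; $W_4^-$ is $W_4$ with one edge from the central vertex removed. $M_4$ consists of an induced $4$--cycle $(x_1,x_2,x_3,x_4)$ and four pairwise adjacent vertices $a_1,a_2,a_3,a_4$ with $a_1\sim x_1,x_2$; $a_2\sim x_2,x_3$; $a_3\sim x_3,x_4$;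 $a_4\sim x_4,x_1$ and no other edges between the $a_i$ and the $x_j$. A pre-median graph is a weakly modular graph with no induced $K_{2,3}$ and no induced $W_4^-$. An induced subgraph $H$ of $G$ is gated if every vertex $x$ has a vertex $x'\in H$ with $x'\in I(x,y)$ for all $y\in H$. $G$ is a gated amalgam of $G_1,G_2$ if $G_1,G_2$ are isomorphic to two intersecting gated subgraphs of $G$ whose union is $G$. A graph with at least two vertices is prime if it is neither a Cartesian product of smaller graphs nor a gated amalgam of smaller graphs. The triangle complex is the $2$--complex with $1$--skeleton $G$ and $2$--cells glued along all $3$--cycles; the clique complex has the finite cliques as simplices. *)

(* Defs.v *)
From Stdlib Require Import List Relations ClassicalEpsilon.
Import ListNotations.

Record graph := Graph {
  V :> Type;
  adj : V -> V -> Prop;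
  adj_sym : forall x y, adj x y -> adj y x;
  adj_irrefl : forall x, ~ adj x x }.

Arguments adj {g} _ _.

Inductive walkn (G : graph) : G -> G -> nat -> Prop :=
| walkn0 : forall u, walkn G u u 0
| walknS : forall u w v n, adj u w -> walkn G w v n -> walkn G u v (S n).

Definition connected (G : graph) : Prop := forall u v : G, exists n, walkn G u v n.

(* graph distance: the least length of a walk (well defined for connected G) *)
Definition dist (G : graph) (u v : G) : nat :=
  epsilon (inhabits 0) (fun n => walkn G u v n /\ forall m, walkn G u v m -> n <= m).

Definition in_interval (G : graph) (u v x : G) : Prop :=
  dist G u x + dist G x v = dist G u v.

Definition has_two_vertices (G : graph) : Prop := exists x y : G, x <> y.

Definition triangle_condition (G : graph) : Prop :=
  forall u v w : G, adj v w -> 1 < dist G u v -> dist G u v = dist G u w ->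
    exists x, adj x v /\ adj x w /\ dist G u x = dist G u v - 1.

Definition quadrangle_condition (G : graph) : Prop :=
  forall u v w z : G, adj v z -> adj w z -> dist G v w = 2 ->
    2 <= dist G u v -> dist G u v = dist G u w -> dist G u z = dist G u v + 1 ->
    exists x, adj x v /\ adj x w /\ dist G u x = dist G u v - 1.

Definition weakly_modular (G : graph) : Prop :=
  triangle_condition G /\ quadrangle_condition G.

Definition local_triangle_condition (G : graph) : Prop :=
  forall u v w : G, adj v w -> dist G u v = 2 -> dist G u w = 2 ->
    exists x, adj x u /\ adj x v /\ adj x w.

Definition local_quadrangle_condition (G : graph) : Prop :=
  forall u v w z : G, adj z v -> adj z w -> dist G v w = 2 ->
    dist G u v = 2 -> dist G u w = 2 -> dist G u z = 3 ->
    exists x, adj x u /\ adj x v /\ adj x w.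

Definition locally_weakly_modular (G : graph) : Prop :=
  local_triangle_condition G /\ local_quadrangle_condition G.

Definition mk_graph (T : Type) (e : T -> T -> bool) (h : forall x, e x x = false)
  : graph.
Proof.
  refine (@Graph T (fun x y => e x y = true \/ e y x = true) _ _).
  - intros x y [H|H]; auto.
  - intros x [H|H]; rewrite h in H; discriminate.
Defined.

Inductive c4v := C1 | C2 | C3 | C4.
Definition c4e (x y : c4v) : bool :=
  match x, y with
  | C1, C2 | C2, C3 | C3, C4 | C4, C1 => true
  | _, _ => false end.
Definition C4graph : graph := @mk_graph c4v c4e (fun x => ltac:(destruct x; reflexivity)).

Inductive k23v := KA1 | KA2 | KB1 | KB2 | KB3.
Definition k23e (x y : k23v) : bool :=
  match x, y with
  | KA1, KB1 | KA1, KB2 | KA1, KB3 | KA2, KB1 | KA2, KB2 | KA2, KB3 => true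
  | _, _ => false end.
Definition K23 : graph := @mk_graph k23v k23e (fun x => ltac:(destruct x; reflexivity)).

Inductive w4v := WC | WR1 | WR2 | WR3 | WR4.
Definition w4e (x y : w4v) : bool :=
  match x, y with
  | WR1, WR2 | WR2, WR3 | WR3, WR4 | WR4, WR1 => true
  | WC, WR1 | WC, WR2 | WC, WR3 | WC, WR4 => true
  | _, _ => false end.
Definition W4 : graph := @mk_graph w4v w4e (fun x => ltac:(destruct x; reflexivity)).

Definition w4me (x y : w4v) : bool :=
  match x, y with
  | WR1, WR2 | WR2, WR3 | WR3, WR4 | WR4, WR1 => true
  | WC, WR2 | WC, WR3 | WC, WR4 => true
  | _, _ => false end.
Definition W4minus : graph := @mk_graph w4v w4me (fun x => ltac:(destruct x; reflexivity)).

Inductive m4v := MX1 | MX2 | MX3 | MX4 | MA1 | MA2 | MA3 | MA4.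
Definition m4e (x y : m4v) : bool :=
  match x, y with
  | MX1, MX2 | MX2, MX3 | MX3, MX4 | MX4, MX1 => true
  | MA1, MA2 | MA1, MA3 | MA1, MA4 | MA2, MA3 | MA2, MA4 | MA3, MA4 => true
  | MA1, MX1 | MA1, MX2 | MA2, MX2 | MA2, MX3
  | MA3, MX3 | MA3, MX4 | MA4, MX4 | MA4, MX1 => true
  | _, _ => false end.
Definition M4 : graph := @mk_graph m4v m4e (fun x => ltac:(destruct x; reflexivity)).

Definition induced_map (H G : graph) (f : H -> G) : Prop :=
  (forall x y, f x = f y -> x = y) /\
  (forall x y, adj (f x) (f y) <-> adj x y).

Definition has_induced (H G : graph) : Prop := exists f : H -> G, induced_map H G f.

Definition pre_median (G : graph) : Prop :=
  weakly_modular G /\ ~ has_induced K23 G /\ ~ has_induced W4minus G.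

Definition squares_in_W4_or_M4 (G : graph) : Prop :=
  forall f : C4graph -> G, induced_map C4graph G f ->
    (exists g : W4 -> G, induced_map W4 G g /\ forall i, exists j, g j = f i) \/
    (exists g : M4 -> G, induced_map M4 G g /\ forall i, exists j, g j = f i).

Definition gated (G : graph) (H : G -> Prop) : Prop :=
  forall x : G, exists x', H x' /\ forall y, H y -> in_interval G x y x'.

Definition nontrivial_gated_amalgam (G : graph) : Prop :=
  exists H1 H2 : G -> Prop, gated G H1 /\ gated G H2 /\
    (exists v, H1 v /\ H2 v) /\ (forall v, H1 v \/ H2 v) /\
    (exists v, ~ H1 v) /\ (exists v, ~ H2 v).

Definition cartprod (G1 G2 : graph) : graph.
Proof.
  refine (@Graph (G1 * G2)%type
    (fun p q => (adj (fst p) (fst q) /\ snd p = snd q) \/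
                (fst p = fst q /\ adj (snd p) (snd q))) _ _).
  - intros [a b] [c d]; simpl; intros [[H1 H2]|[H1 H2]].
    + left; split; [apply adj_sym; exact H1 | symmetry; exact H2].
    + right; split; [symmetry; exact H1 | apply adj_sym; exact H2].
  - intros [a b]; simpl; intros [[H _]|[_ H]]; eapply adj_irrefl; exact H.
Defined.

Definition isomorphic (G H : graph) : Prop :=
  exists (f : G -> H) (g : H -> G),
    (forall x, g (f x) = x) /\ (forall y, f (g y) = y) /\
    (forall x y, adj (f x) (f y) <-> adj x y).

Definition nontrivial_product (G : graph) : Prop :=
  exists G1 G2 : graph, connected G1 /\ connected G2 /\
    has_two_vertices G1 /\ has_two_vertices G2 /\ isomorphic (cartprod G1 G2) G.

Definition prime (G : graph) : Prop :=
  has_two_vertices G /\ ~ nontrivial_product G /\ ~ nontrivial_gated_amalgam G.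

Inductive walk_in (G : graph) (P : G -> Prop) : G -> G -> Prop :=
| walk_in0 : forall u, P u -> walk_in G P u u
| walk_inS : forall u w v, P u -> adj u w -> walk_in G P w v -> walk_in G P u v.

Definition two_connected (G : graph) : Prop :=
  connected G /\ has_two_vertices G /\
  forall z u v : G, u <> z -> v <> z -> walk_in G (fun x => x <> z) u v.

Fixpoint is_walk (G : graph) (l : list G) : Prop :=
  match l with
  | x :: ((y :: _) as t) => adj x y /\ is_walk G t
  | _ => True
  end.

(* elementary homotopies of edge paths in the triangle complex *)
Definition elem_move (G : graph) (l l' : list G) : Prop :=
  (exists l1 l2 x y, adj x y /\ l = l1 ++ x :: l2 /\ l' = l1 ++ x :: y :: x :: l2) \/
  (exists l1 l2 x y z, adj x y /\ adj y z /\ adj x z /\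
       l = l1 ++ x :: z :: l2 /\ l' = l1 ++ x :: y :: z :: l2).

Definition homotopic (G : graph) : list G -> list G -> Prop :=
  clos_refl_sym_trans (list G) (elem_move G).

Definition triangle_simply_connected (G : graph) : Prop :=
  forall (v : G) (l : list G), is_walk G (v :: l ++ [v]) ->
    homotopic G (v :: l ++ [v]) [v].

(* Main.v *)
(* Call [hull u v] the least set that contains [u], [v] and every vertex with two neighbours in
   it, and call [G] elementary if all hulls of edges are everything. In a weakly modular graph
   these hulls are gated. All four conditions are compared with elementarity.

   Prime => elementary: in a pre-median graph the fibres of the gate map of a gated set are gated.
   It follows that any edge between two fibres of [H := hull u v] spans a parallel copy of [H].
   Let [U w] be the vertices of the fibre over [w] with a neighbour in another fibre. If some
   [U w] is not the whole fibre, [G] is a gated amalgam along [U w]; otherwise [G] is the product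
   of [H] and a fibre. If [G] is prime then [H] must be everything.

   Elementary => every square lies in a W4 or M4: otherwise a square [u v v' u'] is thin. Thin
   squares propagate across triangles and across cubes, so the edge [u u'] is transported in
   parallel along geodesics from [u]. The vertices so reached are closed under adding vertices
   with two neighbours among them, hence contain [hull u v], but not [u'].

   Squares in W4 or M4 => the triangle complex is simply connected, because TC and QC contract
   every closed walk through triangles and squares.

   2-connected and simply connected => elementary: if [H := hull u v] is proper, a coboundary on
   the edges inside [H] extended by zero vanishes on triangles, but not on a cycle that leaves [H]
   and comes back at another vertex.

   Locally weakly modular and simply connected => weakly modular: the balls of the universal cover
   are built level by level, the new vertices being pairs (vertex of the last sphere, missing
   neighbour of its image) up to having a common parent. They satisfy TC and QC at the base point.
   Any instance of TC or QC in [G] involves finitely many homotopies, so it lifts to a large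
   enough ball. *)

Require Import Defs.
From Stdlib Require Import List Relations Lia Arith ZArith Classical ClassicalEpsilon.
From Stdlib Require Import FunctionalExtensionality PropExtensionality.
Import ListNotations.

Ltac contra_adj :=
  exfalso;
  match goal with
  | H : adj ?x ?x |- _ => exact (adj_irrefl _ _ H)
  | H : ~ adj ?x ?y, K : adj ?x ?y |- _ => exact (H K)
  | H : ~ adj ?x ?y, K : adj ?y ?x |- _ => exact (H (adj_sym _ _ _ K))
  | H : ?x <> ?x |- _ => exact (H eq_refl)
  | H : ?x <> ?y, K : ?x = ?y |- _ => exact (H K)
  | H : ?x <> ?y, K : ?y = ?x |- _ => exact (H (eq_sym K))
  end.
Ltac adj_solve :=
  solve [ assumption | apply adj_sym; assumption | contra_adj | reflexivity
        | intro; contra_adj | intro; subst; contra_adj | subst; contra_adj ].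

(** * Graph distance as the least length of a walk *)

Section Distance.
Context (G : graph).
Implicit Types u v w x y z : G.

Lemma walkn_snoc u v w n : walkn G u v n -> adj v w -> walkn G u w (S n).
Proof.
  induction 1; intro A.
  - econstructor; [exact A | constructor].
  - econstructor; eauto.
Qed.

Lemma walkn_sym u v n : walkn G u v n -> walkn G v u n.
Proof.
  induction 1.
  - constructor.
  - eapply walkn_snoc; [eassumption | apply adj_sym; assumption].
Qed.

Lemma walkn_app u v w m n : walkn G u v m -> walkn G v w n -> walkn G u w (m + n).
Proof. induction 1; simpl; intros; auto; econstructor; eauto. Qed.

Context (HG : connected G).

(** Connectedness and well-founded induction provide a least walk length, so the choice in [dist]
    returns it and not the default value. *)
Lemma dist_spec u v : walkn G u v (dist G u v) /\ forall m, walkn G u v m -> dist G u v <= m.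
Proof.
  unfold dist. apply epsilon_spec.
  destruct (HG u v) as [n Hn].
  induction n as [n IH] using lt_wf_ind.
  destruct (classic (exists m, m < n /\ walkn G u v m)) as [[m [Hm Wm]]|N].
  - apply (IH m Hm Wm).
  - exists n; split; auto. intros m Wm.
    destruct (le_lt_dec n m); auto. exfalso; eauto.
Qed.

Lemma dist_walk u v : walkn G u v (dist G u v).
Proof. apply dist_spec. Qed.

Lemma dist_le u v m : walkn G u v m -> dist G u v <= m.
Proof. apply dist_spec. Qed.

Lemma dist_sym u v : dist G u v = dist G v u.
Proof.
  apply Nat.le_antisymm; apply dist_le; apply walkn_sym; apply dist_walk.
Qed.

Lemma dist_tri u v w : dist G u w <= dist G u v + dist G v w.
Proof. apply dist_le. eapply walkn_app; apply dist_walk. Qed.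

Lemma dist_refl u : dist G u u = 0.
Proof. assert (dist G u u <= 0) by (apply dist_le; constructor). lia. Qed.

Lemma dist0 u v : dist G u v = 0 -> u = v.
Proof. intro E. pose proof (dist_walk u v) as W. rewrite E in W. now inversion W. Qed.

Lemma dist1 u v : dist G u v = 1 <-> adj u v.
Proof.
  split.
  - intro E. pose proof (dist_walk u v) as W. rewrite E in W.
    inversion W as [|? w ? ? A W']; subst. inversion W'; subst. exact A.
  - intro A.
    assert (dist G u v <= 1) by (apply dist_le; econstructor; [exact A|constructor]).
    assert (dist G u v <> 0)
      by (intro E; apply dist0 in E; subst; exact (adj_irrefl _ _ A)).
    lia.
Qed.

Lemma dist2 u v x : u <> v -> ~ adj u v -> adj u x -> adj x v -> dist G u v = 2.
Proof.
  intros Huv Nuv Hux Hxv.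
  assert (dist G u v <= 2)
    by (apply dist_le; econstructor; [exact Hux|]; econstructor; [exact Hxv|constructor]).
  assert (dist G u v <> 0) by (intro E; apply dist0 in E; auto).
  assert (dist G u v <> 1) by (intro E; apply dist1 in E; auto).
  lia.
Qed.

Lemma dist2_inv u v : dist G u v = 2 -> u <> v /\ ~ adj u v /\ exists x, adj u x /\ adj x v.
Proof.
  intro E. split; [|split].
  - intros ->. rewrite dist_refl in E. lia.
  - intro A. apply dist1 in A. lia.
  - pose proof (dist_walk u v) as W. rewrite E in W.
    inversion W as [|? w ? ? A W']; subst.
    inversion W' as [|? w' ? ? A' W'']; subst. inversion W''; subst. eauto.
Qed.

Lemma dist_adj u v w : adj v w -> dist G u w <= S (dist G u v).
Proof.
  intro A. pose proof (dist_tri u v w). apply dist1 in A. lia.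
Qed.

Lemma dist_step u v n : dist G u v = S n -> exists w, adj u w /\ dist G w v = n.
Proof.
  intro E. pose proof (dist_walk u v) as W. rewrite E in W.
  inversion W as [|? w ? ? A W']; subst. exists w; split; auto.
  pose proof (dist_le _ _ _ W').
  pose proof (dist_tri u w v). apply dist1 in A. lia.
Qed.

Lemma dist_step_r u v n : dist G u v = S n -> exists w, adj w v /\ dist G u w = n.
Proof.
  rewrite dist_sym. intro E. destruct (dist_step _ _ _ E) as [w [A D]].
  exists w. rewrite dist_sym. split; auto. apply adj_sym; auto.
Qed.

End Distance.

(** * Squares *)

Record square (G : graph) (a b c d : G) : Prop := Square {
  sq_ab : adj a b; sq_bc : adj b c; sq_cd : adj c d; sq_da : adj d a;
  sq_nac : ~ adj a c; sq_nbd : ~ adj b d; sq_eac : a <> c; sq_ebd : b <> d }.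
Arguments square {G}.

Definition coned (G : graph) (a b c d : G) : Prop :=
  exists e, adj e a /\ adj e b /\ adj e c /\ adj e d.
Arguments coned {G}.

Section Local.
Context (G : graph).
Implicit Types a b c d e p q s t u v w x y z : G.

Lemma square_rot a b c d : square a b c d -> square b c d a.
Proof. intros []; constructor; adj_solve. Qed.

Lemma square_flip a b c d : square a b c d -> square b a d c.
Proof. intros []; constructor; adj_solve. Qed.

Lemma square_rev a b c d : square a b c d -> square a d c b.
Proof. intros []; constructor; adj_solve. Qed.

Lemma coned_rot a b c d : coned a b c d -> coned b c d a.
Proof. intros [e []]; exists e; tauto. Qed.

Lemma coned_rev a b c d : coned a b c d -> coned a d c b.
Proof. intros [e []]; exists e; tauto. Qed.

Context (noK : ~ has_induced K23 G).

Lemma K23_free a1 a2 b1 b2 b3 :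
  a1 <> a2 -> ~ adj a1 a2 ->
  adj b1 a1 -> adj b2 a1 -> adj b3 a1 -> adj b1 a2 -> adj b2 a2 -> adj b3 a2 ->
  b1 <> b2 -> b1 <> b3 -> b2 <> b3 ->
  adj b1 b2 \/ adj b1 b3 \/ adj b2 b3.
Proof.
  intros. apply NNPP. intro N.
  assert (~ adj b1 b2 /\ ~ adj b1 b3 /\ ~ adj b2 b3) as [N1 [N2 N3]] by tauto. clear N.
  apply noK.
  exists (fun i : k23v => match i with
    KA1 => a1 | KA2 => a2 | KB1 => b1 | KB2 => b2 | KB3 => b3 end).
  split.
  - intros [] []; intro E; solve [reflexivity | adj_solve].
  - intros [] []; simpl; split; intro E;
      solve [ now auto | adj_solve | destruct E; discriminate ].
Qed.

Context (noW : ~ has_induced W4minus G).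

Lemma W4minus_free a b c d e :
  square a b c d -> adj e a -> adj e b -> adj e c -> adj e d.
Proof.
  intros [] Hea Heb Hec. apply NNPP. intro Ned.
  apply noW.
  exists (fun i : w4v => match i with
    WC => e | WR1 => d | WR2 => a | WR3 => b | WR4 => c end).
  split.
  - intros [] []; intro E; solve [reflexivity | adj_solve].
  - intros [] []; simpl; split; intro E;
      solve [ now auto | adj_solve | destruct E; discriminate ].
Qed.

(** A common neighbour of [a] and [c] other than [b] and [d] completes a [K23] unless it is adjacent
    to [b] or [d]; [W4minus_free] then gives the other adjacency. *)
Lemma square_common a b c d x :
  square a b c d -> adj x a -> adj x c -> x = b \/ x = d \/ (adj x b /\ adj x d).
Proof.
  intros S Hxa Hxc. pose proof S as [].
  destruct (classic (x = b)) as [|Nb]; auto.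
  destruct (classic (x = d)) as [|Nd]; auto.
  right; right.
  destruct (K23_free a c x b d) as [K|[K|K]]; try adj_solve.
  - split; auto. apply (W4minus_free a b c d); auto.
  - split; auto. apply (W4minus_free a d c b); auto using square_rev.
Qed.

(** By [square_common] a second fourth corner would be adjacent to [b], a diagonal. So transport
    across squares is single-valued. *)
Lemma square_unique a b c d d' : square a b c d -> square a b c d' -> d = d'.
Proof.
  intros S [? ? ? ? ? ? ? ?].
  destruct (square_common a b c d d' S) as [E|[E|[E _]]]; adj_solve || (symmetry; exact E) || auto.
Qed.

End Local.

(* Adjacencies of an induced [W4] or [M4] around [abcd]; in a square that is not coned, the
   non-adjacencies of [M4] follow from the absence of [W4minus]. *)
Definition thick (G : graph) (a b c d : G) : Prop :=
  coned a b c d \/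
  exists p1 p2 p3 p4, (adj p1 a /\ adj p1 b) /\ (adj p2 b /\ adj p2 c) /\
    (adj p3 c /\ adj p3 d) /\ (adj p4 d /\ adj p4 a) /\
    (adj p1 p2 /\ adj p1 p3 /\ adj p1 p4 /\ adj p2 p3 /\ adj p2 p4 /\ adj p3 p4).
Arguments thick {G}.

Definition thin (G : graph) (a b c d : G) : Prop := square a b c d /\ ~ thick a b c d.
Arguments thin {G}.

Ltac dihedral rot rev :=
  let rots := first [ assumption | apply rot; assumption
                    | apply rot; apply rot; assumption
                    | apply rot; apply rot; apply rot; assumption ] in
  solve [ rots | apply rev; rots ].

Section ThinSymmetry.
Context (G : graph).
Implicit Types a b c d e p q s t u v w x y z : G.

Lemma thick_rot a b c d : thick a b c d -> thick b c d a.
Proof.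
  intros [C|[p1 [p2 [p3 [p4 P]]]]]; [left; apply coned_rot; auto|right].
  exists p2, p3, p4, p1. decompose [and] P. repeat split; adj_solve.
Qed.

Lemma thick_rev a b c d : thick a b c d -> thick a d c b.
Proof.
  intros [C|[p1 [p2 [p3 [p4 P]]]]]; [left; apply coned_rev; auto|right].
  exists p4, p3, p2, p1. decompose [and] P. repeat split; adj_solve.
Qed.

Lemma thin_rot a b c d : thin a b c d -> thin b c d a.
Proof.
  intros [S N]. split; [apply square_rot; auto|].
  intro T; apply N. do 3 apply thick_rot in T. exact T.
Qed.

Lemma thin_rev a b c d : thin a b c d -> thin a d c b.
Proof.
  intros [S N]. split; [apply square_rev; auto|].
  intro T; apply N. apply thick_rev in T. exact T.
Qed.

Lemma thin_flip a b c d : thin a b c d -> thin b a d c.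
Proof. intro T. apply thin_rev, thin_rot in T. do 2 apply thin_rot in T. exact T. Qed.

Lemma thin_not_coned a b c d : thin a b c d -> ~ coned a b c d.
Proof. intros [_ N] C; apply N; left; auto. Qed.

Lemma thin_square a b c d : thin a b c d -> square a b c d.
Proof. intros [S _]; exact S. Qed.

End ThinSymmetry.

Ltac sq_solve :=
  match goal with
  | |- square _ _ _ _ => dihedral square_rot square_rev
  | |- thin _ _ _ _ => dihedral thin_rot thin_rev
  | |- coned _ _ _ _ => dihedral coned_rot coned_rev
  end.

(** * Thin squares across triangles and cubes *)

Section Thin.
Context (G : graph) (HG : connected G).
Implicit Types a b c d e p q s t u v w x y z : G.

Lemma local_triangle_adj (LTC : local_triangle_condition G) u v w p q :
  adj v w -> u <> v -> ~ adj u v -> u <> w -> ~ adj u w ->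
  adj u p -> adj p v -> adj u q -> adj q w ->
  exists x, adj x u /\ adj x v /\ adj x w.
Proof. intros. apply LTC; eauto using dist2. Qed.

(* If [z] is not at distance 3 from [u], the first alternative holds. *)
Lemma local_quadrangle_adj (LQC : local_quadrangle_condition G) u v w z p q :
  adj z v -> adj z w -> v <> w -> ~ adj v w ->
  u <> v -> ~ adj u v -> u <> w -> ~ adj u w ->
  adj u p -> adj p v -> adj u q -> adj q w ->
  u <> z -> ~ adj u z ->
  (exists y, adj y u /\ adj y z) \/ exists x, adj x u /\ adj x v /\ adj x w.
Proof.
  intros Hzv. intros.
  destruct (classic (exists y, adj y u /\ adj y z)) as [|N]; auto. right.
  assert (dist G u v = 2) by eauto using dist2.
  assert (dist G u w = 2) by eauto using dist2.
  apply (LQC u v w z); auto.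
  - apply dist2 with z; auto using adj_sym.
  - pose proof (dist_adj G HG u v z (adj_sym _ _ _ Hzv)).
    assert (dist G u z <> 0) by (intro E; apply dist0 in E; auto).
    assert (dist G u z <> 1) by (intro E; apply dist1 in E; auto).
    assert (dist G u z <> 2).
    { intro E; apply dist2_inv in E; auto.
      destruct E as [_ [_ [y [? ?]]]]. apply N; exists y; auto using adj_sym. }
    lia.
Qed.

Context (LTC : local_triangle_condition G) (LQC : local_quadrangle_condition G).
Context (noK : ~ has_induced K23 G) (noW : ~ has_induced W4minus G).

Local Notation wfree := (W4minus_free G noW).
Local Notation sq_common := (square_common G noK noW).
Local Notation sq_unique := (square_unique G noK noW).

(** LTC based at [t] and applied to the edge [c d] gives [s]. As there is no cone, [W4minus_free]
    keeps [t] away from [c], [d] and [s] away from [a], [b], and a prism with triangles [a b t] and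
    [d c s] results. *)
Lemma prism_extension a b c d t :
  square a b c d -> ~ coned a b c d -> adj t a -> adj t b ->
  exists s, adj s t /\ adj s c /\ adj s d /\ square a t s d /\ square b t s c.
Proof.
  intros S N Ta Tb. pose proof S as [].
  assert (Ntc : ~ adj t c).
  { intro A. apply N. exists t. pose proof (wfree _ _ _ _ t S). tauto. }
  assert (Ntd : ~ adj t d).
  { intro A. apply N. exists t.
    pose proof (wfree _ _ _ _ t (square_flip _ _ _ _ _ S)). tauto. }
  destruct (local_triangle_adj LTC t c d b a) as [s [? [Sc Sd]]]; try adj_solve.
  assert (Nsa : ~ adj s a).
  { intro A. apply N. exists s.
    pose proof (wfree _ _ _ _ s (square_rot _ _ _ _ _ (square_rot _ _ _ _ _ S))). tauto. }
  assert (Nsb : ~ adj s b).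
  { intro A. apply N. exists s.
    pose proof (wfree _ _ _ _ s (square_rev _ _ _ _ _ (square_rot _ _ _ _ _ S))).
    pose proof (wfree _ _ _ _ s (square_rev _ _ _ _ _
      (square_rot _ _ _ _ _ (square_rot _ _ _ _ _ (square_rot _ _ _ _ _ S))))).
    tauto. }
  exists s. repeat split; adj_solve.
Qed.

(** Thickness can be tested at one corner. If [p = q], this vertex is a cone; otherwise both
    triangles are pushed to the opposite sides by [prism_extension], and the four apexes form the
    clique of an [M4]. *)
Lemma corner_thick a b c d p q :
  square a b c d -> adj p a -> adj p b -> adj q a -> adj q d -> p = q \/ adj p q ->
  thick a b c d.
Proof.
  intros S Pa Pb Qa Qd Hpq.
  destruct (classic (coned a b c d)) as [|N]; [left; auto|].
  destruct Hpq as [<-|Hpq].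
  { exfalso; apply N. exists p.
    pose proof (wfree _ _ _ _ p (square_flip _ _ _ _ _ S)). tauto. }
  right.
  destruct (prism_extension a b c d p S N Pa Pb) as [p' [? [? [? [S1 S2]]]]].
  destruct (prism_extension a d c b q (square_rev _ _ _ _ _ S)) as [q' [? [? [? [S3 S4]]]]];
    auto; [intro C; apply N; apply coned_rev; auto|].
  (* Each remaining edge of the clique comes from a vertex adjacent to three corners of a side of a
     prism. *)
  assert (adj q p').
  { apply (wfree d a p p'); try adj_solve. do 3 apply square_rot; auto. }
  assert (adj p q').
  { apply (wfree b a q q'); try adj_solve. do 3 apply square_rot; auto. }
  assert (adj q' p').
  { apply (wfree c b p p'); try adj_solve. do 3 apply square_rot; auto. }
  exists p, q', p', q. repeat split; adj_solve.
Qed.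

Lemma thin_prism_side a b c d t s :
  thin a b c d -> adj t a -> adj t b -> adj s t -> adj s c -> adj s d ->
  square a t s d -> square b t s c -> ~ thick a t s d.
Proof.
  intros [S N] Ta Tb Hst Sc Sd S1 S2 K. apply N.
  pose proof S as []. pose proof S1 as []. pose proof S2 as [].
  destruct (classic (coned a t s d)) as [[e [? [? [? ?]]]]|N1].
  { apply (corner_thick a b c d t e); try adj_solve; auto. right; adj_solve. }
  destruct K as [|[p [q [r [w K]]]]]; [contradiction|].
  decompose [and] K; clear K.
  destruct (classic (adj p b)) as [Pb|Npb].
  { apply (corner_thick a b c d p w); try adj_solve; auto. }
  apply NNPP; intro NT.
  assert (NC : ~ coned a b c d) by (intro; apply NT; left; auto).
  assert (CN : forall x, adj x a -> adj x c -> x = b \/ x = d).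
  { intros x X1 X2. destruct (sq_common a b c d x S X1 X2) as [|[|[? ?]]]; auto.
    exfalso; apply NC; exists x; auto. }
  assert (Npd : ~ adj p d).
  { intro. apply N1. exists p. pose proof (wfree _ _ _ _ p (square_flip _ _ _ _ _ S1)). tauto. }
  assert (Nqa : ~ adj q a).
  { intro. apply N1. exists q. pose proof (wfree _ _ _ _ q S1). tauto. }
  assert (Nqd : ~ adj q d).
  { intro. apply N1. exists q.
    pose proof (wfree _ _ _ _ q (square_rot _ _ _ _ _ S1)). tauto. }
  assert (Nqb : ~ adj q b).
  { intro. apply NT. do 3 apply thick_rot.
    apply thick_rev. apply (corner_thick b a d c t q); try adj_solve; auto.
    - apply square_flip; auto.
    - apply (wfree b t s c); try adj_solve; auto.
    - right; adj_solve. }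
  assert (Nqc : ~ adj q c).
  { intro. apply Nqb. apply (wfree t s c b); try adj_solve. apply square_rot; auto. }
  assert (Npc : ~ adj p c).
  { intro. destruct (CN p); try adj_solve. }
  assert (p <> c) by adj_solve.
  (* Either outcome leads to a common neighbour of [c] and [a] that is adjacent to [p] or to [q]. By
     [CN] it is [b] or [d], and neither of these is adjacent to [p] or [q]. *)
  destruct (local_quadrangle_adj LQC c a q p b s) as [[y [? ?]]|[x [? [? ?]]]]; try adj_solve.
  - destruct (local_triangle_adj LTC c a p b y) as [x [? [? ?]]]; try adj_solve.
    destruct (CN x); adj_solve.
  - destruct (CN x); adj_solve.
Qed.

Lemma thin_prism a b c d t :
  thin a b c d -> adj t a -> adj t b ->
  exists s, adj s t /\ adj s c /\ adj s d /\ thin a t s d /\ thin b t s c.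
Proof.
  intros T Ta Tb.
  destruct (prism_extension a b c d t) as [s [? [? [? [S1 S2]]]]]; auto.
  { apply T. } { apply thin_not_coned; auto. }
  exists s. do 3 (split; auto). split; split; auto.
  - eapply (thin_prism_side a b c d t s); eauto.
  - eapply (thin_prism_side b a d c t s); eauto using thin_flip.
Qed.

(** The apex [e] cuts the base into four triangles. Thin squares are carried over each of them, and
    uniqueness of the fourth corner makes the results match. *)
Lemma thin_over_coned_square c a z w a' c' z' :
  thin c a a' c' -> thin a z z' a' -> adj w c -> adj w z -> coned c a z w ->
  exists w', thin c w w' c' /\ thin z w w' z'.
Proof.
  intros T1 T2 Wc Wz [e [? [? [? ?]]]].
  destruct (thin_prism c a a' c' e) as [e' [? [? [? [T3 T4]]]]]; auto.
  destruct (thin_prism c e e' c' w) as [w' [? [? [? [T5 T6]]]]]; try adj_solve; auto.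
  destruct (thin_prism a e e' a' z) as [z'' [? [? [? [T7 T8]]]]]; try adj_solve; auto.
  { apply thin_square in T2; destruct T2; adj_solve. }
  assert (z'' = z').
  { apply (sq_unique z a a' z'' z'); apply thin_square, thin_flip; auto. }
  subst z''.
  destruct (thin_prism e z z' e' w) as [w'' [? [? [? [T9 T10]]]]]; try adj_solve; auto.
  assert (w'' = w').
  { apply (sq_unique w e e' w'' w'); apply thin_square, thin_flip; auto. }
  subst w''. exists w'. auto.
Qed.

(** A thick face over [c w] has vertices [p] over [c w] and [q] over [c c'] that are equal or
    adjacent. Pushed to the opposite sides, they become [p1] and [q1] at the corner [a] of the thin
    square [a z z' a'], where [corner_thick] forbids equality and adjacency. *)
Lemma thin_cube_face c a z w a' c' z' w' :
  thin c a a' c' -> thin a z z' a' -> square c a z w -> ~ coned c a z w ->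
  square c w w' c' -> thin c w w' c'.
Proof.
  intros T1 T2 B NB S. split; auto. intro K.
  assert (exists p q, adj p c /\ adj p w /\ adj q c /\ adj q c' /\ (p = q \/ adj p q))
    as [p [q [Pc [Pw [Qc [Qc' Hpq]]]]]].
  { destruct K as [[e [? [? [? ?]]]]|[p1 [p2 [p3 [p4 K]]]]].
    - exists e, e; tauto.
    - decompose [and] K. exists p1, p4. tauto. }
  pose proof (thin_square _ _ _ _ _ T1) as S1. pose proof (thin_square _ _ _ _ _ T2) as S2.
  destruct (prism_extension c w z a p) as [p1 [P1 [P1z [P1a [Sp _]]]]]; auto using square_rev.
  { intro C; apply NB; apply coned_rev; auto. }
  destruct (prism_extension c c' a' a q) as [q1 [Q1 [Q1a' [Q1a [Sq _]]]]]; auto using square_rev.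
  { intro C. apply (thin_not_coned _ _ _ _ _ T1). apply coned_rev; auto. }
  assert (Hc : p1 = q1 \/ adj p1 q1 -> False).
  { intro H. apply T2. apply (corner_thick a z z' a' p1 q1); auto. }
  destruct Hpq as [<-|Hpq].
  { apply Hc. left. apply (sq_unique a c p); do 3 apply square_rot; auto. }
  (* With a cone [e], the triangles [c a e], [c e p], [c p w] carry the thin square over [c a] to
     the one over [c w]. Without it, the prism over [c p p1 a] with apex [q] shows that [p1] and
     [q1] are adjacent. *)
  destruct (classic (coned c p p1 a)) as [[e [? [? [? ?]]]]|N].
  - destruct (thin_prism c a a' c' e) as [e' [? [? [? [T3 T4]]]]]; auto.
    destruct (thin_prism c e e' c' p) as [p' [? [? [? [T5 T6]]]]]; try adj_solve; auto.
    pose proof (sq_da _ _ _ _ _ B) as Wc.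
    destruct (thin_prism c p p' c' w) as [w'' [? [? [? [T7 T8]]]]]; try adj_solve; auto.
    assert (w'' = w').
    { apply (sq_unique w c c'); apply square_flip; auto using thin_square. }
    subst. apply T7; auto.
  - destruct (prism_extension c p p1 a q) as [q2 [? [? [? [Sq2 _]]]]]; auto using adj_sym.
    apply Hc. right.
    assert (q2 = q1) by (apply (sq_unique a c q); do 3 apply square_rot; auto).
    subst; adj_solve.
Qed.

(** If the base is not coned, LQC based at [w], for [c'] and [z'] below [a'], supplies [w']. The
    unwanted chords are excluded by unique corners and by [C1], [C2]; thinness is
    [thin_cube_face]. *)
Lemma thin_cube c a z w a' c' z' :
  thin c a a' c' -> thin a z z' a' -> square c a z w ->
  exists w', thin c w w' c' /\ thin z w w' z'.
Proof.
  intros T1 T2 B.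
  pose proof (sq_cd _ _ _ _ _ B) as Wz. pose proof (sq_da _ _ _ _ _ B) as Wc.
  destruct (classic (coned c a z w)) as [C|N].
  { apply (thin_over_coned_square c a z w a'); auto using adj_sym. }
  pose proof (thin_square _ _ _ _ _ T1) as S1. pose proof (thin_square _ _ _ _ _ T2) as S2.
  pose proof B as []. pose proof S1 as []. pose proof S2 as [].
  assert (C1 : forall x, adj x c -> adj x a' -> x = a \/ x = c').
  { intros x X1 X2. destruct (sq_common c a a' c' x) as [|[|[? ?]]]; auto.
    exfalso. apply (thin_not_coned _ _ _ _ _ T1). exists x; auto. }
  assert (C2 : forall x, adj x z -> adj x a' -> x = a \/ x = z').
  { intros x X1 X2. destruct (sq_common z a a' z' x) as [|[|[? ?]]]; auto using square_flip.
    exfalso. apply (thin_not_coned _ _ _ _ _ T2). exists x; auto. }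
  assert (c' <> z').
  { intros <-. destruct (sq_common a a' c' c z) as [|[|[? ?]]]; adj_solve || sq_solve. }
  assert (Nz'c : ~ adj z' c).
  { intro A. destruct (C1 z'); adj_solve. }
  assert (Nc'z : ~ adj c' z).
  { intro A. destruct (C2 c'); adj_solve. }
  assert (Nc'z' : ~ adj c' z').
  { intro A.
    destruct (prism_extension c' a' a c z') as [x [? [? [? [X1 X2]]]]]; try adj_solve.
    - sq_solve.
    - intros C. apply (thin_not_coned _ _ _ _ _ T1). sq_solve.
    - assert (z = x) by (apply (sq_unique z' a' a); sq_solve). adj_solve. }
  assert (Nwc' : ~ adj w c').
  { intro A.
    destruct (prism_extension c c' a' a w) as [s [? [? [? [X1 X2]]]]]; try adj_solve.
    - sq_solve.
    - intros C. apply (thin_not_coned _ _ _ _ _ T1). sq_solve.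
    - assert (z = s) by (apply (sq_unique w c a); sq_solve). adj_solve. }
  assert (Nwz' : ~ adj w z').
  { intro A.
    destruct (prism_extension z z' a' a w) as [s [? [? [? [X1 X2]]]]]; try adj_solve.
    - sq_solve.
    - intros C. apply (thin_not_coned _ _ _ _ _ T2). sq_solve.
    - assert (c = s) by (apply (sq_unique w z a); sq_solve). adj_solve. }
  assert (Nwa' : ~ adj w a').
  { intro A. destruct (C1 w); adj_solve. }
  assert (exists w', adj w' w /\ adj w' c' /\ adj w' z') as [w' [Hw [Hc Hz]]].
  (* The other alternative is a common neighbour of [w] and [a']. Two uses of LTC turn it into a
     vertex [e] that is a corner of the base or a cone over it, and both are impossible. *)
  { destruct (local_quadrangle_adj LQC w c' z' a' c z) as [[y [? ?]]|E]; try adj_solve; auto.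
    exfalso.
    destruct (local_triangle_adj LTC w c' a' c y) as [x [? [? ?]]]; try adj_solve.
    assert (~ adj x c).
    { intro. destruct (C1 x); adj_solve. }
    assert (~ adj x a).
    { intro. apply (thin_not_coned _ _ _ _ _ T1). exists x.
      assert (adj x c) by (apply (wfree c' a' a c x); adj_solve || sq_solve). adj_solve. }
    destruct (local_triangle_adj LTC a w x c a') as [e [? [? ?]]]; try adj_solve.
    destruct (sq_common a z w c e) as [|[|[? ?]]]; try adj_solve.
    - sq_solve.
    - subst e. destruct (C2 x); adj_solve.
    - apply N. exists e. repeat split; adj_solve. }
  assert (~ adj w' c).
  { intro A.
    destruct (prism_extension c c' a' a w') as [s [? [? [? [X1 X2]]]]]; try adj_solve.
    - sq_solve.
    - intros C. apply (thin_not_coned _ _ _ _ _ T1). sq_solve.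
    - pose proof X1 as []. pose proof X2 as [].
      destruct (sq_common w' z' a' c' s) as [|[|[? ?]]]; try adj_solve.
      constructor; adj_solve. }
  assert (~ adj w' z).
  { intro A.
    destruct (prism_extension z z' a' a w') as [s [? [? [? [X1 X2]]]]]; try adj_solve.
    - sq_solve.
    - intros C. apply (thin_not_coned _ _ _ _ _ T2). sq_solve.
    - pose proof X1 as []. pose proof X2 as [].
      destruct (sq_common w' z' a' c' s) as [|[|[? ?]]]; try adj_solve.
      constructor; adj_solve. }
  exists w'. split.
  - apply (thin_cube_face c a z w a' c' z' w'); auto. constructor; adj_solve.
  - apply (thin_cube_face z a c w a' z' c' w'); try sq_solve.
    + intro C; apply N; sq_solve.
    + constructor; adj_solve.
Qed.

End Thin.

(** * Hulls of edges and elementary graphs *)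

Inductive hull (G : graph) (u v : G) : G -> Prop :=
| hull_l : hull G u v u
| hull_r : hull G u v v
| hull_step : forall x a b, hull G u v a -> hull G u v b -> a <> b ->
    adj x a -> adj x b -> hull G u v x.
Arguments hull {G}.

Definition closed2 (G : graph) (K : G -> Prop) : Prop :=
  forall x a b, K a -> K b -> a <> b -> adj x a -> adj x b -> K x.
Arguments closed2 {G}.

Definition elementary (G : graph) : Prop :=
  has_two_vertices G /\ forall u v x : G, adj u v -> hull u v x.

Section Hull.
Context (G : graph).
Implicit Types u v w x y z : G.

Lemma hull_closed2 u v : closed2 (hull u v).
Proof. intros x a b Ha Hb. eapply hull_step; eauto. Qed.

Lemma hull_min u v (K : G -> Prop) :
  closed2 K -> K u -> K v -> forall x, hull u v x -> K x.
Proof. intros C Ku Kv x H. induction H; eauto. Qed.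
End Hull.

(** * Working forms of TC and QC *)

Section WeaklyModular.
Context (G : graph) (HG : connected G) (WM : weakly_modular G).
Implicit Types u v w x y z : G.

(** The case of distance one is included, with [u] itself as the common neighbour. *)
Lemma wm_triangle u v w n :
  adj v w -> dist G u v = S n -> dist G u w = S n ->
  exists x, adj x v /\ adj x w /\ dist G u x = n.
Proof.
  intros A Ev Ew. destruct n as [|n].
  - exists u. rewrite dist1 in Ev, Ew by auto. rewrite dist_refl; auto.
  - destruct (proj1 WM u v w) as [x [? [? Ex]]]; auto; try lia.
    exists x. repeat split; auto. lia.
Qed.

(** Adjacent [v] and [w] are allowed and handled by TC; at distance one the witness is [u]. *)
Lemma wm_quadrangle u v w z n :
  v <> w -> adj v z -> adj w z -> dist G u v = n -> dist G u w = n -> dist G u z = S n ->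
  exists x, adj x v /\ adj x w /\ S (dist G u x) = n.
Proof.
  intros Nvw Vz Wz Ev Ew Ez. destruct n as [|n].
  { apply dist0 in Ev, Ew; auto. congruence. }
  destruct (classic (adj v w)) as [A|A].
  { destruct (wm_triangle u v w n) as [x [? [? ?]]]; auto.
    exists x; auto. }
  destruct n as [|n].
  - exists u. rewrite dist1 in Ev, Ew by auto. rewrite dist_refl; auto.
  - destruct (proj2 WM u v w z) as [x [? [? Ex]]]; auto; try lia.
    { apply dist2 with z; auto using adj_sym. }
    exists x. repeat split; auto. lia.
Qed.

Lemma wm_local_triangle : local_triangle_condition G.
Proof.
  intros u v w A Ev Ew.
  destruct (wm_triangle u v w 1) as [x [? [? Ex]]]; auto.
  exists x. repeat split; auto. apply adj_sym, dist1; auto.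
Qed.

Lemma wm_local_quadrangle : local_quadrangle_condition G.
Proof.
  intros u v w z Zv Zw Evw Ev Ew Ez.
  destruct (wm_quadrangle u v w z 2) as [x [? [? Ex]]]; auto using adj_sym.
  { intros <-. rewrite dist_refl in Evw; auto; lia. }
  exists x. repeat split; auto. apply adj_sym, dist1; auto.
Qed.

End WeaklyModular.

(** * Parallel transport across thin squares *)

Section Ladder.
Context (G : graph) (HG : connected G) (WM : weakly_modular G).
Context (noK : ~ has_induced K23 G) (noW : ~ has_induced W4minus G).
Implicit Types a b c d e p q s t u v w x y z : G.
Local Notation sq_unique := (square_unique G noK noW).
Local Notation prism := (thin_prism G HG (wm_local_triangle G HG WM)
  (wm_local_quadrangle G HG WM) noK noW).
Local Notation cube := (thin_cube G HG (wm_local_triangle G HG WM)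
  (wm_local_quadrangle G HG WM) noK noW).

Context (u u' : G).

(* Parallel transport of the edge [u u'] along geodesics from [u], across thin squares. *)
Inductive ladder : G -> G -> Prop :=
| ladder_base : ladder u u'
| ladder_step : forall a a' z z', ladder a a' -> dist G u z = S (dist G u a) ->
    thin a z z' a' -> ladder z z'.

Lemma thin_unique a b c d d' : thin a b c d -> thin a b c d' -> d = d'.
Proof. intros S1 S2; apply (sq_unique a b c); apply thin_square; auto. Qed.

(** Let [a] be the predecessor recorded in the ladder. QC gives [c] below [a] and [w], which carries
    a rung by induction; two prisms, or a cube over [c a z w], then produce the rung at [w]. *)
Lemma ladder_down z z' w :
  ladder z z' -> adj w z -> dist G u z = S (dist G u w) ->
  exists w', ladder w w' /\ thin w z z' w'.
Proof.
  remember (dist G u z) as n eqn:En. revert z z' w En.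
  induction n as [n IH] using lt_wf_ind. intros z z' w En L Wz Ew.
  destruct L as [|a a' z z' L Ea T].
  { rewrite dist_refl in En; auto; lia. }
  destruct (classic (w = a)) as [->|Nwa]; [eauto|].
  assert (Za : adj z a) by (apply thin_square in T; destruct T; adj_solve).
  destruct (wm_quadrangle G HG WM u w a z (dist G u a)) as [c [Cw [Ca Ec]]];
    auto using adj_sym; try lia.
  destruct (IH (dist G u a) ltac:(lia) a a' c) as [c' [Lc Tc]]; auto.
  destruct (classic (adj w a)) as [A|A].
  - destruct (prism c a a' c' w) as [w' [? [? [? [T1 T2]]]]]; auto using adj_sym.
    destruct (prism a z z' a' w) as [w'' [? [? [? [T3 T4]]]]]; auto.
    assert (w'' = w').
    { apply (thin_unique w a a'); sq_solve. }
    subst w''. exists w'. split; [|sq_solve].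
    apply (ladder_step c c'); auto. lia.
  - destruct (cube c a z w a' c' z') as [w' [T1 T2]]; auto.
    { constructor; try adj_solve; intro B.
      - pose proof (dist_adj G HG u c z B). lia.
      - subst; lia. }
    exists w'. split; [|sq_solve].
    apply (ladder_step c c'); auto. lia.
Qed.

(** At a neighbour nearer to [u] the rungs agree by induction, and the fourth corner of a square is
    unique. *)
Lemma ladder_functional z z1 z2 : ladder z z1 -> ladder z z2 -> z1 = z2.
Proof.
  remember (dist G u z) as n eqn:En. revert z z1 z2 En.
  induction n as [|n IH]; intros z z1 z2 En L1 L2.
  - destruct L1; [|lia]. remember u as y in L2 at 1. destruct L2; auto. subst; lia.
  - destruct (dist_step_r G HG u z n) as [w [Wz Ew]]; auto.
    destruct (ladder_down z z1 w) as [w1 [Lw1 T1]]; auto; try lia.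
    destruct (ladder_down z z2 w) as [w2 [Lw2 T2]]; auto; try lia.
    assert (w1 = w2) by (apply (IH w); auto). subst w2.
    apply (thin_unique z w w1); sq_solve.
Qed.

Definition has_ladder z := exists z', ladder z z'.

Lemma has_ladder_down z w :
  has_ladder z -> adj w z -> dist G u z = S (dist G u w) -> has_ladder w.
Proof.
  intros [z' L] A E. destruct (ladder_down z z' w) as [w' [? _]]; auto. exists w'; auto.
Qed.

Lemma has_ladder_level z w :
  has_ladder z -> adj w z -> dist G u z = dist G u w -> has_ladder w.
Proof.
  intros [z' L] A E. destruct (dist G u z) as [|n] eqn:En.
  { exists z'. symmetry in E. apply dist0 in En, E; auto. congruence. }
  destruct (wm_triangle G HG WM u w z n) as [c [Cw [Cz Ec]]]; auto.
  destruct (ladder_down z z' c) as [c' [Lc T]]; auto; try lia.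
  destruct (prism c z z' c' w) as [w' [? [? [? [T1 T2]]]]]; auto using adj_sym.
  exists w'. apply (ladder_step c c'); auto; lia.
Qed.

(** The common lower neighbour [c] carries a single rung, so the thin squares over [c p] and [c q]
    fit together and extend to [s]. *)
Lemma has_ladder_up s p q :
  has_ladder p -> has_ladder q -> p <> q -> adj s p -> adj s q ->
  dist G u s = S (dist G u p) -> dist G u s = S (dist G u q) -> has_ladder s.
Proof.
  intros [p' Lp] [q' Lq] Npq Sp Sq Ep Eq.
  destruct (wm_quadrangle G HG WM u p q s (dist G u p)) as [c [Cp [Cq Ec]]];
    auto using adj_sym; try lia.
  destruct (ladder_down p p' c) as [c' [Lc Tp]]; auto.
  destruct (ladder_down q q' c) as [c2 [Lc2 Tq]]; auto; try lia.
  assert (c2 = c') by (apply (ladder_functional c); auto). subst c2.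
  assert (exists s', thin p s s' p') as [s' T].
  { destruct (classic (adj p q)) as [A|A].
    - destruct (prism c p p' c' q) as [q2 [? [? [? [T1 T2]]]]]; auto using adj_sym.
      destruct (prism p q q2 p' s) as [s' [? [? [? [T3 T4]]]]]; auto.
      exists s'; auto.
    - destruct (cube p c q s c' p' q') as [s' [T1 T2]]; auto.
      + sq_solve.
      + constructor; try adj_solve; intro B.
        * pose proof (dist_adj G HG u c s B). lia.
        * subst; lia.
      + exists s'; auto. }
  exists s'. apply (ladder_step p p'); auto.
Qed.

(** One neighbour with a rung suffices unless it is nearer to [u]; when both are nearer,
    [has_ladder_up] applies. *)
Lemma has_ladder_closed2 : closed2 has_ladder.
Proof.
  assert (E : forall s p, adj s p -> has_ladder p ->
    has_ladder s \/ dist G u s = S (dist G u p)).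
  { intros s p A Lp.
    pose proof (dist_adj G HG u s p A). pose proof (dist_adj G HG u p s (adj_sym _ _ _ A)).
    destruct (Nat.eq_dec (dist G u s) (dist G u p)) as [D|D];
      [left; eapply has_ladder_level; eauto|].
    destruct (Nat.eq_dec (dist G u p) (S (dist G u s))) as [D'|D'];
      [left; eapply has_ladder_down; eauto|right; lia]. }
  intros s p q Lp Lq N Sp Sq.
  destruct (E s p Sp Lp) as [|Ep]; auto. destruct (E s q Sq Lq) as [|Eq]; auto.
  apply (has_ladder_up s p q); auto.
Qed.

(** Stepping down from [u'] to [u] would give a square with [u'] at two opposite corners. *)
Lemma has_ladder_top : adj u u' -> ~ has_ladder u'.
Proof.
  intros A [z' L].
  destruct (ladder_down u' z' u) as [u2 [L2 T]]; auto.
  { rewrite dist_refl by auto. apply dist1; auto. }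
  assert (u2 = u') by (apply (ladder_functional u); auto using ladder_base). subst u2.
  apply thin_square in T; destruct T; adj_solve.
Qed.

End Ladder.

Lemma elementary_thick (G : graph) : connected G -> pre_median G -> elementary G ->
  forall a b c d : G, square a b c d -> thick a b c d.
Proof.
  intros HG [WM [noK noW]] [_ E] a b c d S. apply NNPP; intro N.
  assert (T : thin a b c d) by (split; auto).
  (* The edge [a d] is transported. Both [a] and [b] carry rungs, so all of [hull a b] does,
     including [d]. *)
  apply (has_ladder_top G HG WM noK noW a d); [destruct S; adj_solve|].
  apply (hull_min G a b (has_ladder G a d)).
  - apply has_ladder_closed2; auto.
  - exists d. apply ladder_base.
  - exists c. apply (ladder_step G a d a d b c); auto.
    + apply ladder_base.
    + rewrite dist_refl by auto. apply dist1; auto. destruct S; auto.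
  - apply E. destruct S; auto.
Qed.

(** * Thick squares and induced W4 or M4 *)

(** As [squares_in_W4_or_M4] only places the corners in the image, every square of [M4] is checked.
    The outer one, in its eight orders, gives the second alternative; all others are coned by a
    vertex of the clique. *)
Lemma M4_squares_thick (a b c d : M4) : square a b c d -> thick a b c d.
Proof.
  intros [AB BC CD DA AC BD EAC EBD].
  destruct a, b; simpl in AB; try (exfalso; destruct AB; discriminate);
  destruct c; simpl in BC; try (exfalso; destruct BC; discriminate);
  simpl in AC; try congruence; try (exfalso; apply AC; now auto);
  destruct d; simpl in CD, DA; try (exfalso; destruct CD; discriminate);
  try (exfalso; destruct DA; discriminate);
  simpl in BD; try congruence; try (exfalso; apply BD; now auto);
  clear;
  first
  [ left; first [ exists (MA1 : M4); repeat split; simpl; now auto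
                | exists (MA2 : M4); repeat split; simpl; now auto
                | exists (MA3 : M4); repeat split; simpl; now auto
                | exists (MA4 : M4); repeat split; simpl; now auto ]
  | right; first
    [ exists (MA1 : M4), (MA2 : M4), (MA3 : M4), (MA4 : M4); repeat split; simpl; now auto
    | exists (MA2 : M4), (MA3 : M4), (MA4 : M4), (MA1 : M4); repeat split; simpl; now auto
    | exists (MA3 : M4), (MA4 : M4), (MA1 : M4), (MA2 : M4); repeat split; simpl; now auto
    | exists (MA4 : M4), (MA1 : M4), (MA2 : M4), (MA3 : M4); repeat split; simpl; now auto
    | exists (MA4 : M4), (MA3 : M4), (MA2 : M4), (MA1 : M4); repeat split; simpl; now auto
    | exists (MA3 : M4), (MA2 : M4), (MA1 : M4), (MA4 : M4); repeat split; simpl; now auto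
    | exists (MA2 : M4), (MA1 : M4), (MA4 : M4), (MA3 : M4); repeat split; simpl; now auto
    | exists (MA1 : M4), (MA4 : M4), (MA3 : M4), (MA2 : M4); repeat split; simpl; now auto ]].
Qed.

Lemma W4_squares_thick (a b c d : W4) : square a b c d -> thick a b c d.
Proof.
  intros [AB BC CD DA AC BD EAC EBD].
  left. exists (WC : W4).
  destruct a, b; simpl in AB; try (exfalso; destruct AB; discriminate);
  destruct c; simpl in BC; try (exfalso; destruct BC; discriminate);
  simpl in AC; try congruence; try (exfalso; apply AC; now auto);
  destruct d; simpl in CD, DA; try (exfalso; destruct CD; discriminate);
  try (exfalso; destruct DA; discriminate);
  simpl in BD; try congruence; try (exfalso; apply BD; now auto);
  repeat split; simpl; now auto.
Qed.

Section Thick.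
Context (G : graph).
Implicit Types a b c d : G.

Lemma square_pull (H : graph) (g : H -> G) (i j k l : H) :
  induced_map H G g -> square (g i) (g j) (g k) (g l) -> square i j k l.
Proof.
  intros [I A] []. constructor; try (apply A; assumption);
    try (intro B; apply A in B; contradiction); congruence.
Qed.

Lemma thick_push (H : graph) (g : H -> G) (i j k l : H) :
  induced_map H G g -> thick i j k l -> thick (g i) (g j) (g k) (g l).
Proof.
  intros [I A] [[e E]|[p1 [p2 [p3 [p4 P]]]]].
  - left. exists (g e). repeat split; apply A; tauto.
  - right. exists (g p1), (g p2), (g p3), (g p4). repeat split; apply A; tauto.
Qed.

Lemma squares_in_thick : squares_in_W4_or_M4 G ->
  forall a b c d, square a b c d -> thick a b c d.
Proof.
  intros Sq a b c d S.
  set (f := fun i : c4v => match i with C1 => a | C2 => b | C3 => c | C4 => d end).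
  assert (I : induced_map C4graph G f).
  { destruct S. split.
    - intros [] []; simpl; intro E; solve [reflexivity | adj_solve].
    - intros [] []; simpl; split; intro E;
        solve [ now auto | adj_solve | destruct E; discriminate ]. }
  destruct (Sq f I) as [[g [Ig J]]|[g [Ig J]]];
    destruct (J C1) as [j1 E1], (J C2) as [j2 E2], (J C3) as [j3 E3], (J C4) as [j4 E4];
    simpl in E1, E2, E3, E4; subst a b c d;
    apply thick_push; auto.
  - apply W4_squares_thick. eapply square_pull; eauto.
  - apply M4_squares_thick. eapply square_pull; eauto.
Qed.

Context (noW : ~ has_induced W4minus G).

Lemma thick_squares_in : (forall a b c d, square a b c d -> thick a b c d) ->
  squares_in_W4_or_M4 G.
Proof.
  intros T f [I A].
  assert (S : square (f C1) (f C2) (f C3) (f C4)).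
  { constructor; try (apply A; simpl; now auto); intro B;
      first [apply A in B; simpl in B; destruct B; discriminate | apply I in B; discriminate]. }
  pose proof S as [].
  destruct (classic (coned (f C1) (f C2) (f C3) (f C4))) as [[e [? [? [? ?]]]]|N].
  - left. exists (fun i : w4v => match i with
      WC => e | WR1 => f C1 | WR2 => f C2 | WR3 => f C3 | WR4 => f C4 end).
    split; [split|].
    + intros [] []; intro E; solve [reflexivity | adj_solve | apply I in E; discriminate].
    + intros [] []; simpl; split; intro E;
        solve [ now auto | adj_solve | destruct E; discriminate ].
    + intros [].
      * exists (WR1 : W4); auto.
      * exists (WR2 : W4); auto.
      * exists (WR3 : W4); auto.
      * exists (WR4 : W4); auto.
  - right.
    destruct (T _ _ _ _ S) as [C|[p1 [p2 [p3 [p4 P]]]]]; [contradiction|].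
    decompose [and] P; clear P.
    set (x1 := f C1) in *. set (x2 := f C2) in *. set (x3 := f C3) in *. set (x4 := f C4) in *.
    (* Without a cone, a vertex over one side is adjacent to no corner of the opposite side. This
       yields the non-edges of [M4]. *)
    assert (Out : forall p a b c d, square a b c d -> ~ coned a b c d ->
      adj p a -> adj p b -> ~ adj p c /\ ~ adj p d).
    { intros p a b c d S' N' Pa Pb. split; intro B; apply N'; exists p.
      - pose proof (W4minus_free G noW a b c d p S'). tauto.
      - pose proof (W4minus_free G noW b a d c p (square_flip _ _ _ _ _ S')). tauto. }
    destruct (Out p1 x1 x2 x3 x4); auto.
    destruct (Out p2 x2 x3 x4 x1); auto.
    { sq_solve. } { intro C; apply N; sq_solve. }
    destruct (Out p3 x3 x4 x1 x2); auto.
    { sq_solve. } { intro C; apply N; sq_solve. }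
    destruct (Out p4 x4 x1 x2 x3); auto.
    { sq_solve. } { intro C; apply N; sq_solve. }
    exists (fun i : m4v => match i with
      MX1 => x1 | MX2 => x2 | MX3 => x3 | MX4 => x4
    | MA1 => p1 | MA2 => p2 | MA3 => p3 | MA4 => p4 end).
    split; [split|].
    + intros [] []; intro E; solve [reflexivity | adj_solve | apply I in E; discriminate].
    + intros [] []; simpl; split; intro E;
        solve [ now auto | adj_solve | destruct E; discriminate ].
    + intros [].
      * exists (MX1 : M4); auto.
      * exists (MX2 : M4); auto.
      * exists (MX3 : M4); auto.
      * exists (MX4 : M4); auto.
Qed.
End Thick.

(** * Contracting closed walks *)

Section Homotopy.
Context (G : graph).
Implicit Types (u v w x y z : G) (l m k : list G).

Lemma homotopic_refl l : homotopic G l l.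
Proof. apply rst_refl. Qed.

Lemma homotopic_sym l m : homotopic G l m -> homotopic G m l.
Proof. apply rst_sym. Qed.

Lemma homotopic_trans l m k : homotopic G l m -> homotopic G m k -> homotopic G l k.
Proof. apply rst_trans. Qed.

Lemma homotopic_context a b l m :
  homotopic G l m -> homotopic G (a ++ l ++ b) (a ++ m ++ b).
Proof.
  intro H. induction H as [l m M|l|l m _ IH|l m k _ IH1 _ IH2].
  - apply rst_step.
    destruct M as [[l1 [l2 [x [y [A [-> ->]]]]]]|[l1 [l2 [x [y [z [A [B [C [-> ->]]]]]]]]]].
    + left. exists (a ++ l1), (l2 ++ b), x, y. rewrite <- !app_assoc. simpl. auto.
    + right. exists (a ++ l1), (l2 ++ b), x, y, z. rewrite <- !app_assoc. simpl. auto 7.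
  - apply rst_refl.
  - apply rst_sym; auto.
  - eapply rst_trans; eauto.
Qed.

Lemma homotopic_triangle x y z :
  adj x y -> adj y z -> adj x z -> homotopic G [x; z] [x; y; z].
Proof. intros. apply rst_step. right. exists [], [], x, y, z. simpl. auto 7. Qed.

Lemma homotopic_back x y : adj x y -> homotopic G [x] [x; y; x].
Proof. intros. apply rst_step. left. exists [], [], x, y. simpl. auto. Qed.

Lemma homotopic_fan x y z e :
  adj x y -> adj y z -> adj e x -> adj e y -> adj e z -> homotopic G [x; y; z] [x; e; z].
Proof.
  intros. apply homotopic_trans with [x; e; y; z].
  - apply (homotopic_context [] [z] [x; y] [x; e; y]). apply homotopic_triangle; adj_solve.
  - apply homotopic_sym.
    apply (homotopic_context [x] [] [e; z] [e; y; z]). apply homotopic_triangle; adj_solve.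
Qed.

Lemma homotopic_two_fans x y z p q :
  adj x y -> adj y z -> adj p x -> adj p y -> adj q y -> adj q z -> adj p q ->
  homotopic G [x; y; z] [x; p; q; z].
Proof.
  intros. apply homotopic_trans with [x; p; y; z].
  - apply (homotopic_context [] [z] [x; y] [x; p; y]). apply homotopic_triangle; adj_solve.
  - apply (homotopic_context [x] [] [p; y; z] [p; q; z]). apply homotopic_fan; adj_solve.
Qed.

(** In the second case the path is swept over the clique: [x p1 p2 z], [x p4 p2 z], [x p4 p3 z], and
    finally [x t z]. *)
Lemma homotopic_thick x y z t :
  square x y z t -> thick x y z t -> homotopic G [x; y; z] [x; t; z].
Proof.
  intros [] [[e E]|[p1 [p2 [p3 [p4 P]]]]].
  - decompose [and] E. apply homotopic_trans with [x; e; z].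
    + apply homotopic_fan; adj_solve.
    + apply homotopic_sym, homotopic_fan; adj_solve.
  - decompose [and] P; clear P.
    apply homotopic_trans with [x; p1; p2; z].
    { apply homotopic_two_fans; adj_solve. }
    apply homotopic_trans with [x; p4; p2; z].
    { apply (homotopic_context [] [z] [x; p1; p2] [x; p4; p2]). apply homotopic_fan; adj_solve. }
    apply homotopic_trans with [x; p4; p3; z].
    { apply (homotopic_context [x] [] [p4; p2; z] [p4; p3; z]). apply homotopic_fan; adj_solve. }
    apply homotopic_sym, homotopic_two_fans; adj_solve.
Qed.

Context (HG : connected G) (WM : weakly_modular G).
Context (thick_squares : forall a b c d : G, square a b c d -> thick a b c d).
Context (v : G).

(* [geodesic x l]: the list [l], followed by [x], is a geodesic from [v] to [x]. *)
Inductive geodesic : G -> list G -> Prop :=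
| geodesic_nil : geodesic v []
| geodesic_snoc : forall x y l, geodesic x l -> adj x y ->
    dist G v y = S (dist G v x) -> geodesic y (l ++ [x]).

Lemma geodesic_exists x : exists l, geodesic x l.
Proof.
  remember (dist G v x) as n eqn:En. revert x En.
  induction n as [|n IH]; intros x En.
  - symmetry in En. apply dist0 in En; auto. subst. exists []; constructor.
  - destruct (dist_step_r G HG v x n) as [w [A E]]; auto.
    destruct (IH w) as [l L]; auto. exists (l ++ [w]).
    apply geodesic_snoc; auto. lia.
Qed.

(** The vertices [a], [b] before [x] have a common neighbour [c] nearer to [v]. By induction both
    geodesics can be rerouted through [c]; then they differ by the two sides of [c a x b], which is
    a pair of triangles or a thick square. *)
Lemma geodesic_homotopic x l m :
  geodesic x l -> geodesic x m -> homotopic G (l ++ [x]) (m ++ [x]).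
Proof.
  remember (dist G v x) as n eqn:En. revert x l m En.
  induction n as [n IH] using lt_wf_ind. intros x l m En Gl Gm.
  pose proof (dist_refl G HG v) as D0.
  inversion Gl as [|a ? l' Ga Aa Ea]; subst; inversion Gm as [|b ? m' Gb Ab Eb]; subst;
    try apply homotopic_refl; try lia.
  clear Gl Gm. rename l' into l.
  destruct (classic (a = b)) as [<-|N].
  { apply (homotopic_context [] [x] (l ++ [a]) (m' ++ [a])). eapply IH; eauto. lia. }
  destruct (wm_quadrangle G HG WM v a b x (dist G v a)) as [c [Ca [Cb Ec]]]; auto; try lia.
  destruct (geodesic_exists c) as [k Gk].
  apply homotopic_trans with (k ++ [c; a; x]).
  { apply homotopic_trans with (((k ++ [c]) ++ [a]) ++ [x]).
    - apply (homotopic_context [] [x] (l ++ [a]) ((k ++ [c]) ++ [a])).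
      apply (IH (dist G v a)); auto; try lia. apply geodesic_snoc; auto.
    - rewrite <- !app_assoc. apply homotopic_refl. }
  apply homotopic_trans with (k ++ [c; b; x]).
  2: { apply homotopic_trans with (((k ++ [c]) ++ [b]) ++ [x]).
    - rewrite <- !app_assoc. apply homotopic_refl.
    - apply (homotopic_context [] [x] ((k ++ [c]) ++ [b]) (m' ++ [b])).
      apply (IH (dist G v b)); auto; try lia. apply geodesic_snoc; auto. lia. }
  apply (homotopic_context k [] [c; a; x] [c; b; x]).
  destruct (classic (adj a b)) as [A|A].
  - apply homotopic_fan; adj_solve.
  - assert (S : square c a x b).
    { constructor; try adj_solve; intro B.
      - pose proof (dist_adj G HG v c x B). lia.
      - subst; lia. }
    apply homotopic_thick; auto.
Qed.

(** An edge going up extends a geodesic, one going down is removed as a backtrack, and a level edge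
    is pushed down over the triangle given by TC. *)
Lemma geodesic_edge x y l m : adj x y -> geodesic x l -> geodesic y m ->
  homotopic G (l ++ [x; y]) (m ++ [y]).
Proof.
  intros A Gl Gm.
  assert (Up : forall x y l m, adj x y -> geodesic x l -> geodesic y m ->
    dist G v y = S (dist G v x) -> homotopic G (l ++ [x; y]) (m ++ [y])).
  { intros a b l1 l2 Aab G1 G2 E.
    apply homotopic_trans with ((l1 ++ [a]) ++ [b]).
    - rewrite <- app_assoc. apply homotopic_refl.
    - apply geodesic_homotopic; auto. apply geodesic_snoc; auto. }
  pose proof (dist_adj G HG v x y A). pose proof (dist_adj G HG v y x (adj_sym _ _ _ A)).
  destruct (Nat.eq_dec (dist G v y) (S (dist G v x))) as [E|E]; auto.
  destruct (Nat.eq_dec (dist G v x) (S (dist G v y))) as [E'|E'].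
  - apply homotopic_trans with ((m ++ [y; x]) ++ [y]).
    + apply homotopic_trans with ((l ++ [x]) ++ [y]).
      { rewrite <- app_assoc. apply homotopic_refl. }
      apply (homotopic_context [] [y] (l ++ [x]) (m ++ [y; x])).
      apply homotopic_sym, Up; auto using adj_sym.
    + rewrite <- app_assoc.
      apply (homotopic_context m [] [y; x; y] [y]).
      apply homotopic_sym, homotopic_back, adj_sym; auto.
  - destruct (dist G v x) as [|n] eqn:Ex.
    { assert (Ey : dist G v y = 0) by lia. apply dist0 in Ex, Ey; auto. adj_solve. }
    destruct (wm_triangle G HG WM v x y n) as [c [Cx [Cy Ec]]]; auto; try lia.
    destruct (geodesic_exists c) as [k Gk].
    apply homotopic_trans with (k ++ [c; x; y]).
    { apply homotopic_trans with ((l ++ [x]) ++ [y]).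
      { rewrite <- app_assoc. apply homotopic_refl. }
      apply homotopic_trans with ((k ++ [c; x]) ++ [y]).
      - apply (homotopic_context [] [y] (l ++ [x]) (k ++ [c; x])).
        apply homotopic_sym, Up; auto. lia.
      - rewrite <- app_assoc. apply homotopic_refl. }
    apply homotopic_trans with (k ++ [c; y]).
    + apply (homotopic_context k [] [c; x; y] [c; y]).
      apply homotopic_sym, homotopic_triangle; auto.
    + apply Up; auto. lia.
Qed.

Lemma is_walk_app_l l m : is_walk G (l ++ m) -> is_walk G l.
Proof.
  induction l as [|x l IH]; simpl; auto. destruct l; simpl in *; auto.
  intros [A W]; split; [exact A|apply IH; exact W].
Qed.

Lemma is_walk_app_r l m : is_walk G (l ++ m) -> is_walk G m.
Proof.
  induction l as [|x l IH]; simpl; auto. intro W. apply IH.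
  destruct (l ++ m); simpl; tauto.
Qed.

Lemma walk_geodesic l x m :
  is_walk G (v :: l ++ [x]) -> geodesic x m -> homotopic G (v :: l ++ [x]) (m ++ [x]).
Proof.
  revert x m. induction l as [|y l IH] using rev_ind; intros x m W Gm.
  - apply (geodesic_edge v x [] m); auto using geodesic_nil. simpl in W; tauto.
  - destruct (geodesic_exists y) as [k Gk].
    rewrite <- app_assoc in *.
    assert (A : adj y x) by (apply (is_walk_app_r (v :: l)) in W; simpl in W; tauto).
    apply homotopic_trans with ((k ++ [y]) ++ [x]).
    + replace (v :: l ++ [y] ++ [x]) with ([] ++ (v :: l ++ [y]) ++ [x])
        by (simpl; rewrite <- app_assoc; reflexivity).
      apply (homotopic_context [] [x]). apply IH; auto.
      apply (is_walk_app_l _ [x]). simpl. rewrite <- app_assoc. exact W.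
    + rewrite <- app_assoc. apply geodesic_edge; auto.
Qed.
End Homotopy.

Lemma thick_simply_connected (G : graph) : connected G -> weakly_modular G ->
  (forall a b c d : G, square a b c d -> thick a b c d) -> triangle_simply_connected G.
Proof.
  intros HG WM T v l W. apply (walk_geodesic G HG WM T v l v []); auto.
  apply geodesic_nil.
Qed.

(** * A cocycle on a proper hull *)

Section Cocycle.
Context (G : graph) (H : G -> Prop) (pot : G -> Z).
Implicit Types (u v w x y z : G) (l m k : list G).
Local Open Scope Z_scope.

(* The coboundary of [pot] on the edges inside [H], extended by zero to all other edges. *)
Definition restricted_diff x y : Z :=
  if excluded_middle_informative (H x /\ H y) then pot y - pot x else 0.

Fixpoint walk_sum l : Z :=
  match l with
  | x :: ((y :: _) as t) => restricted_diff x y + walk_sum t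
  | _ => 0
  end.

Lemma restricted_diff_in x y : H x -> H y -> restricted_diff x y = pot y - pot x.
Proof. unfold restricted_diff. destruct excluded_middle_informative; tauto. Qed.

Lemma restricted_diff_out x y : ~ H x \/ ~ H y -> restricted_diff x y = 0.
Proof. unfold restricted_diff. destruct excluded_middle_informative; tauto. Qed.

Lemma walk_sum_app l x m : walk_sum (l ++ x :: m) = walk_sum (l ++ [x]) + walk_sum (x :: m).
Proof.
  induction l as [|y l IH]; [reflexivity|].
  destruct l as [|z l].
  - simpl. lia.
  - change (restricted_diff y z + walk_sum ((z :: l) ++ x :: m) =
      restricted_diff y z + walk_sum ((z :: l) ++ [x]) + walk_sum (x :: m)).
    rewrite IH. lia.
Qed.

Context (H_closed : closed2 H).

(** A triangle with two vertices in [H] lies in [H], so either all three edges carry the coboundary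
    or all three carry zero. *)
Lemma restricted_diff_triangle x y z : adj x y -> adj y z -> adj x z ->
  restricted_diff x z = restricted_diff x y + restricted_diff y z.
Proof.
  intros Axy Ayz Axz.
  assert (C : forall a b c : G, H a -> H b -> adj a b -> adj c a -> adj c b -> H c).
  { intros a b c Ha Hb Aab Aca Acb. apply (H_closed c a b); auto. adj_solve. }
  pose proof (C x y z). pose proof (C y z x). pose proof (C x z y).
  assert (adj z x /\ adj z y /\ adj y x) by (repeat split; adj_solve).
  destruct (classic (H x)), (classic (H y)), (classic (H z));
    try (rewrite !restricted_diff_in by tauto; lia);
    try (rewrite !restricted_diff_out by tauto; lia);
    exfalso; tauto.
Qed.

Lemma walk_sum_move l m : elem_move G l m -> walk_sum l = walk_sum m.
Proof.
  intros [[l1 [l2 [x [y [A [-> ->]]]]]]|[l1 [l2 [x [y [z [A [B [C [-> ->]]]]]]]]]].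
  - rewrite (walk_sum_app l1 x l2), (walk_sum_app l1 x (y :: x :: l2)).
    change (walk_sum (x :: y :: x :: l2)) with
      (restricted_diff x y + (restricted_diff y x + walk_sum (x :: l2))).
    destruct (classic (H x)), (classic (H y));
      try (rewrite !restricted_diff_in by tauto; lia);
      rewrite !restricted_diff_out by tauto; lia.
  - rewrite (walk_sum_app l1 x (z :: l2)), (walk_sum_app l1 x (y :: z :: l2)).
    change (walk_sum (x :: y :: z :: l2)) with
      (restricted_diff x y + (restricted_diff y z + walk_sum (z :: l2))).
    change (walk_sum (x :: z :: l2)) with (restricted_diff x z + walk_sum (z :: l2)).
    rewrite (restricted_diff_triangle x y z) by auto. lia.
Qed.

Lemma walk_sum_homotopic l m : homotopic G l m -> walk_sum l = walk_sum m.
Proof. induction 1; auto using walk_sum_move; congruence. Qed.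

(** Walks recorded with their sums, so that pieces can be concatenated before any list is formed. *)
Inductive walk_with_sum : G -> G -> Z -> Prop :=
| walk_with_sum_nil : forall u, walk_with_sum u u 0
| walk_with_sum_cons : forall u w v s, adj u w -> walk_with_sum w v s ->
    walk_with_sum u v (restricted_diff u w + s).

Lemma walk_with_sum_trans u v w s t :
  walk_with_sum u v s -> walk_with_sum v w t -> walk_with_sum u w (s + t).
Proof.
  induction 1 as [|u x v s A W IH]; intro W'.
  - exact W'.
  - replace (restricted_diff u x + s + t) with (restricted_diff u x + (s + t)) by lia.
    constructor; auto.
Qed.

Lemma walk_with_sum_edge u v : adj u v -> walk_with_sum u v (restricted_diff u v).
Proof.
  intro A. rewrite <- (Z.add_0_r (restricted_diff u v)).
  apply walk_with_sum_cons; auto. constructor.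
Qed.

Lemma walk_with_sum_list u v s : walk_with_sum u v s ->
  exists l, is_walk G (u :: l) /\ walk_sum (u :: l) = s /\
    ((l = [] /\ u = v) \/ exists l', l = l' ++ [v]).
Proof.
  induction 1 as [u|u w v s A W [l [I [S E]]]].
  - exists []. simpl. auto.
  - exists (w :: l). split; [split; auto|]. split.
    + change (restricted_diff u w + walk_sum (w :: l) = restricted_diff u w + s). congruence.
    + right. destruct E as [[-> ->]|[l' ->]]; [exists []|exists (w :: l')]; reflexivity.
Qed.

Lemma closed_walk_sum u s : triangle_simply_connected G -> walk_with_sum u u s -> s = 0.
Proof.
  intros SC W. destruct (walk_with_sum_list u u s W) as [l [I [S [[-> _]|[l' ->]]]]].
  - symmetry; exact S.
  - rewrite <- S. apply (walk_sum_homotopic _ [u]). apply SC; auto.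
Qed.
End Cocycle.

(** * Elementarity, 2-connectedness and primality *)

Section Elementary.
Context (G : graph) (HG : connected G).
Implicit Types u v w x y z : G.

Lemma exit_edge (H : G -> Prop) u v : H u -> ~ H v -> exists x y, H x /\ ~ H y /\ adj x y.
Proof.
  intros Hu Hv. destruct (HG u v) as [n W].
  induction W as [|u w v n A W IH]; [contradiction|].
  destruct (classic (H w)); eauto.
Qed.

Lemma neighbor_exists u v : u <> v -> exists w, adj u w.
Proof.
  intro N. destruct (HG u v) as [n W]. destruct W; [contradiction|eauto].
Qed.

Lemma simply_connected_elementary :
  two_connected G -> triangle_simply_connected G -> elementary G.
Proof.
  intros [_ [H2 TC]] SC. split; auto. intros a b x Aab.
  apply NNPP; intro Nx.
  destruct (exit_edge (hull a b) a x (hull_l _ _ _) Nx) as [p [q [Hp [Hq Apq]]]].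
  set (H := hull a b) in *.
  assert (HC : closed2 H) by apply hull_closed2.
  (* With the indicator of the exit vertex [p] as potential, a walk inside [H] from another vertex
     to [p] has sum 1. *)
  set (pot := fun y => if excluded_middle_informative (y = p) then 1%Z else 0%Z).
  assert (To : forall y, H y -> walk_with_sum G H pot y a (pot a - pot y) /\
                               walk_with_sum G H pot a y (pot y - pot a)).
  { assert (E : forall y z s t, H y -> H z -> adj y z ->
      walk_with_sum G H pot z a s /\ walk_with_sum G H pot a z t ->
      walk_with_sum G H pot y a (pot z - pot y + s) /\
      walk_with_sum G H pot a y (t + (pot y - pot z))).
    { intros y z s t Hy Hz A [W1 W2].
      rewrite <- !(restricted_diff_in G H pot) by auto. split.
      - econstructor; eauto.
      - eapply walk_with_sum_trans; eauto.
        apply walk_with_sum_edge, adj_sym; auto. }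
    assert (B : walk_with_sum G H pot a a (pot a - pot a) /\
                walk_with_sum G H pot a a (pot a - pot a)).
    { rewrite Z.sub_diag. split; constructor. }
    intros y Hy. induction Hy as [| |y c d Hc IHc Hd IHd N Ac Ad].
    - exact B.
    - destruct (E b a _ _ (hull_r _ _ _) (hull_l _ _ _) (adj_sym _ _ _ Aab) B) as [E1 E2].
      replace (pot a - pot b)%Z with (pot a - pot b + (pot a - pot a))%Z by lia.
      replace (pot b - pot a)%Z with (pot a - pot a + (pot b - pot a))%Z by lia.
      auto.
    - assert (Hy : H y) by (apply (HC y c d); auto).
      destruct (E y c _ _ Hy Hc Ac IHc) as [E1 E2].
      replace (pot a - pot y)%Z with (pot c - pot y + (pot a - pot c))%Z by lia.
      replace (pot y - pot a)%Z with (pot c - pot a + (pot y - pot c))%Z by lia.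
      auto. }
  assert (exists o, H o /\ o <> p) as [o [Ho No]].
  { destruct (classic (a = p)) as [<-|N]; [exists b|exists a]; split; auto;
      try apply hull_l; try apply hull_r. adj_solve. }
  (* A walk from [q] that avoids [p] returns to [H] at some [r]; up to the first return every edge
     has an end outside [H]. *)
  assert (exists r, H r /\ r <> p /\ walk_with_sum G H pot q r 0%Z) as [r [Hr [Nr W]]].
  { assert (W : walk_in G (fun x => x <> p) q o) by (apply TC; adj_solve || congruence).
    clear Apq Nx. induction W as [q Nq|q w o Nq A W IH]; [contradiction|].
    assert (Z0 : restricted_diff G H pot q w = 0%Z) by (apply restricted_diff_out; auto).
    assert (C : forall r, walk_with_sum G H pot w r 0%Z -> walk_with_sum G H pot q r 0%Z).
    { intros r W'. replace 0%Z with (restricted_diff G H pot q w + 0)%Z by lia.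
      econstructor; eauto. }
    destruct (classic (H w)) as [Hw|Hw].
    - exists w. repeat split; auto.
      + destruct W; auto.
      + apply C. constructor.
    - destruct IH as [r [Hr [Nr W']]]; auto.
      exists r. auto. }
  (* The closed walk goes from [p] to [q], on to [r], and back to [p] inside [H] by way of [a]. Its
     sum is 1. *)
  assert (L : walk_with_sum G H pot p p (restricted_diff G H pot p q +
     (0 + (pot a - pot r + (pot p - pot a))))).
  { econstructor; eauto. eapply walk_with_sum_trans; eauto.
    eapply walk_with_sum_trans; apply To; auto. }
  apply closed_walk_sum in L; auto.
  rewrite restricted_diff_out in L by auto.
  unfold pot in L. do 3 destruct excluded_middle_informative; try lia; contradiction.
Qed.

(** If [z] separated [u] from [v], the component of [u] in the rest together with [z] would be
    closed under two neighbours; it contains an edge at [u], hence everything. *)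
Lemma elementary_two_connected : elementary G -> two_connected G.
Proof.
  intros [H2 E]. split; [|split]; auto. intros z u v Nu Nv.
  apply NNPP; intro N.
  set (K := fun x => x = z \/ walk_in G (fun x => x <> z) u x).
  assert (snoc : forall x y w, walk_in G (fun x => x <> z) w x -> adj x y -> y <> z ->
    walk_in G (fun x => x <> z) w y).
  { intros x y w W A Ny. induction W.
    - econstructor; eauto. constructor; auto.
    - econstructor; eauto. }
  assert (KC : closed2 K).
  { intros x a b Ka Kb Nab Aa Ab.
    destruct (classic (x = z)) as [|Nx]; [left; auto|right].
    destruct Ka as [->|Ka].
    - destruct Kb as [->|Kb]; [congruence|]. eapply snoc; eauto using adj_sym.
    - eapply snoc; eauto using adj_sym. }
  destruct (neighbor_exists u z Nu) as [w A].
  assert (Ku : K u) by (right; constructor; auto).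
  assert (Kw : K w).
  { destruct (classic (w = z)); [left; auto|right].
    econstructor; eauto. constructor; auto. }
  destruct (hull_min G u w K KC Ku Kw v (E u w v A)); contradiction.
Qed.

(** If the gate of [x] were not [x], it would lie on both edges [x a] and [x b] and so equal both
    [a] and [b]. *)
Lemma gated_closed2 (H : G -> Prop) : gated G H -> closed2 H.
Proof.
  intros Gd x a b Ha Hb N Aa Ab. destruct (Gd x) as [x' [Hx' I]].
  pose proof (I a Ha) as Ia. pose proof (I b Hb) as Ib. unfold in_interval in *.
  apply dist1 in Aa, Ab; auto. rewrite Aa in Ia. rewrite Ab in Ib.
  destruct (dist G x x') as [|n] eqn:E.
  - apply dist0 in E; auto. subst; auto.
  - exfalso. assert (dist G x' a = 0) by lia. assert (dist G x' b = 0) by lia.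
    apply N. apply dist0 in H0, H1; auto. congruence.
Qed.

Lemma elementary_closed2 (K : G -> Prop) u v x :
  elementary G -> closed2 K -> K u -> K v -> adj u v -> K x.
Proof. intros [_ E] KC Ku Kv A. apply (hull_min G u v K); auto. Qed.

(** A layer of a product and the parts of an amalgam are closed under two neighbours. The layer
    contains an edge, and one of the parts contains an edge at a common vertex, so it would be
    everything. *)
Lemma elementary_prime : elementary G -> prime G.
Proof.
  intro E. split; [apply E|split].
  - intros [G1 [G2 [C1 [C2 [[p [q Npq]] [[b [b' Nb]] [f [g [gf [fg Af]]]]]]]]]].
    set (K := fun x => snd (g x) = b).
    assert (KC : closed2 K).
    { intros x a c Ka Kc Nac Aa Ac. unfold K in *.
      rewrite <- (fg x), <- (fg a) in Aa. rewrite <- (fg x), <- (fg c) in Ac.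
      apply Af in Aa, Ac.
      assert (Ng : g a <> g c) by (intro F; apply Nac; rewrite <- (fg a), <- (fg c), F; auto).
      destruct (g x) as [s t], (g a) as [a1 a2], (g c) as [c1 c2]; simpl in *.
      destruct Aa as [[_ ->]|[<- _]]; auto. destruct Ac as [[_ ->]|[<- _]]; auto.
      exfalso; apply Ng; congruence. }
    destruct (C1 p q) as [n W]. destruct W as [|p w q n A _]; [contradiction|].
    assert (KF : K (f (p, b'))).
    { apply (elementary_closed2 K (f (p, b)) (f (w, b)) _ E KC).
      - unfold K. rewrite gf. auto.
      - unfold K. rewrite gf. auto.
      - apply Af. simpl. auto. }
    unfold K in KF. rewrite gf in KF. simpl in KF. congruence.
  - intros [H1 [H2 [Gd1 [Gd2 [[v [V1 V2]] [U [[v1 N1] [v2 N2]]]]]]]].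
    destruct (neighbor_exists v v1) as [w A]; [intros ->; contradiction|].
    destruct (U w) as [Hw|Hw].
    + apply N1. apply (elementary_closed2 H1 v w); auto using gated_closed2.
    + apply N2. apply (elementary_closed2 H2 v w); auto using gated_closed2.
Qed.
End Elementary.

Lemma pred_ext (A : Type) (P Q : A -> Prop) : (forall x, P x <-> Q x) -> P = Q.
Proof. intro E. extensionality x. apply propositional_extensionality; auto. Qed.

(** * Gated sets and the decomposition of prime graphs *)

(** [lia] treats [dist G a b] and [dist G b a] as unrelated, so each symmetry equation is added once
    beforehand. *)
Ltac dist_lia :=
  repeat match goal with
  | HG : connected ?G |- context [dist ?G ?a ?b] =>
    lazymatch goal with
    | _ : dist G a b = dist G b a |- _ => fail
    | _ : dist G b a = dist G a b |- _ => fail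
    | _ => pose proof (dist_sym G HG a b)
    end
  | HG : connected ?G, _ : context [dist ?G ?a ?b] |- _ =>
    lazymatch goal with
    | _ : dist G a b = dist G b a |- _ => fail
    | _ : dist G b a = dist G a b |- _ => fail
    | _ => pose proof (dist_sym G HG a b)
    end
  end; lia.

Section Gates.
Context (G : graph) (HG : connected G).
Implicit Types (a b p q s t u v w x y z : G) (A B K : G -> Prop).
Local Notation d := (dist G).

Definition is_gate K x x' := K x' /\ forall y, K y -> d x y = d x x' + d x' y.

Definition gate K x : G := epsilon (inhabits x) (is_gate K x).

Lemma is_gate_gated K : (forall x, exists x', is_gate K x x') -> gated G K.
Proof.
  intros E x. destruct (E x) as [x' [Kx' I]]. exists x'. split; auto.
  intros y Ky. unfold in_interval. symmetry; auto.
Qed.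

Lemma gate_spec K x : gated G K -> is_gate K x (gate K x).
Proof.
  intro Gd. unfold gate. apply epsilon_spec.
  destruct (Gd x) as [x' [Kx' I]]. exists x'. split; auto.
  intros y Ky. symmetry. apply I; auto.
Qed.

Lemma gate_in K x : gated G K -> K (gate K x).
Proof. intro Gd; apply gate_spec; auto. Qed.

Lemma gate_dist K x y : gated G K -> K y -> d x y = d x (gate K x) + d (gate K x) y.
Proof. intro Gd; apply gate_spec; auto. Qed.

Lemma gate_eq K x x' : gated G K -> is_gate K x x' -> gate K x = x'.
Proof.
  intros Gd [Kx' I]. pose proof (gate_dist K x x' Gd Kx').
  pose proof (I _ (gate_in K x Gd)).
  apply dist0; auto. dist_lia.
Qed.

Lemma gate_id K x : gated G K -> K x -> gate K x = x.
Proof.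
  intros Gd Kx. apply gate_eq; auto. split; auto. intros. rewrite dist_refl; auto.
Qed.

Lemma gate_adj K x a : gated G K -> ~ K x -> K a -> adj x a -> gate K x = a.
Proof.
  intros Gd N Ka Aa. pose proof (gate_dist K x a Gd Ka) as E.
  apply dist1 in Aa; auto. rewrite Aa in E.
  destruct (d x (gate K x)) as [|n] eqn:E'.
  - apply dist0 in E'; auto. exfalso; apply N. rewrite E'. apply gate_in; auto.
  - apply dist0; auto. lia.
Qed.

Lemma gate_edge K x y : gated G K -> adj x y -> gate K x <> gate K y ->
  adj (gate K x) (gate K y) /\ d x (gate K x) = d y (gate K y).
Proof.
  intros Gd A N.
  pose proof (gate_dist K x (gate K y) Gd (gate_in K y Gd)).
  pose proof (gate_dist K y (gate K x) Gd (gate_in K x Gd)).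
  pose proof (dist_adj G HG (gate K x) x y A).
  pose proof (dist_adj G HG (gate K y) y x (adj_sym _ _ _ A)).
  assert (d (gate K x) (gate K y) <> 0) by (intro E; apply dist0 in E; auto).
  split; [apply dist1; auto|]; dist_lia.
Qed.

Lemma gate_interval K x a :
  gated G K -> d x a + d a (gate K x) = d x (gate K x) -> gate K a = gate K x.
Proof.
  intros Gd E. apply gate_eq; auto. split; [apply gate_in; auto|].
  intros y Ky. pose proof (gate_dist K x y Gd Ky).
  pose proof (dist_tri G HG x a y). pose proof (dist_tri G HG a (gate K x) y). lia.
Qed.

(** The gate in [B] of [gate A b] lies on a geodesic from [gate A b] to [b], so [gate_interval]
    applies. *)
Lemma gate_gate_gate A B b : gated G A -> gated G B -> B b ->
  gate A (gate B (gate A b)) = gate A b.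
Proof.
  intros GA GB Bb. apply gate_interval; auto.
  pose proof (gate_dist B (gate A b) b GB Bb).
  dist_lia.
Qed.

(** The distances from [a1] to [gate B a2] and from [a2] to [gate B a1] each decompose through two
    gates; comparing the sums gives both equalities. *)
Lemma mutual_gates_isometry A B a1 a2 : gated G A -> gated G B -> A a1 -> A a2 ->
  gate A (gate B a1) = a1 -> gate A (gate B a2) = a2 ->
  d (gate B a1) (gate B a2) = d a1 a2 /\ d a1 (gate B a1) = d a2 (gate B a2).
Proof.
  intros GA GB A1 A2 E1 E2.
  pose proof (gate_in B a1 GB) as B1. pose proof (gate_in B a2 GB) as B2.
  pose proof (gate_dist B a1 _ GB B2) as P1.
  pose proof (gate_dist B a2 _ GB B1) as P2.
  pose proof (gate_dist A (gate B a1) _ GA A2) as P3.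
  pose proof (gate_dist A (gate B a2) _ GA A1) as P4.
  rewrite E1 in P3. rewrite E2 in P4.
  split; dist_lia.
Qed.

(* Dress and Scharlau: the gates in [A] of the points of a gated set [B] form a gated set. *)
Lemma mutual_gates_gated A B : gated G A -> gated G B ->
  gated G (fun a => A a /\ gate A (gate B a) = a).
Proof.
  intros GA GB. apply is_gate_gated. intro x.
  set (c := gate A x). set (b := gate B c). set (a := gate A b).
  assert (Bb : B b) by (apply gate_in; auto).
  assert (Aa : A a) by (apply gate_in; auto).
  assert (Ea : gate A (gate B a) = a) by (apply gate_gate_gate; auto).
  exists a. split; [split; auto|]. intros a2 [A2 E2].
  assert (Ac : A c) by (apply gate_in; auto).
  assert (Eb : gate B a = b) by (apply (gate_gate_gate B A c); auto).
  destruct (mutual_gates_isometry A B a a2) as [I1 I2]; auto.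
  rewrite Eb in I1, I2.
  pose proof (gate_in B a2 GB) as B2.
  pose proof (gate_dist B c _ GB B2) as P1. fold b in P1.
  pose proof (gate_dist A (gate B a2) _ GA Ac) as P2. rewrite E2 in P2.
  pose proof (gate_dist A b _ GA Ac) as P3. fold a in P3.
  pose proof (gate_dist A x _ GA A2) as P4. fold c in P4.
  pose proof (gate_dist A x _ GA Aa) as P5. fold c in P5.
  dist_lia.
Qed.

(** * Connected sets closed under two neighbours are gated *)

Context (WM : weakly_modular G).

(** A path inside [K] from [y] to [p] that comes nearer to [x] at every step certifies that [p] lies
    between [x] and [y]. *)
Inductive descends K x p : G -> Prop :=
| descends_end : descends K x p p
| descends_step : forall y z, descends K x p z -> K y -> adj y z ->
    d x y = S (d x z) -> descends K x p y.

(** Let [p] be a point of [K] nearest to [x]. The points that descend to [p] are closed under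
    adjacency in [K]; as [K] is connected they are all of [K], and [p] is the gate. *)
Lemma closed2_gated K x0 : K x0 -> closed2 K ->
  (forall y z, K y -> K z -> walk_in G K y z) -> gated G K.
Proof.
  intros K0 KC Conn. apply is_gate_gated. intro x.
  assert (exists p, K p /\ forall y, K y -> d x p <= d x y) as [p [Kp Min]].
  { remember (d x x0) as n eqn:En. revert x0 K0 En.
    induction n as [n IH] using lt_wf_ind; intros x0 K0 En.
    destruct (classic (exists y, K y /\ d x y < n)) as [[y [Ky L]]|N].
    - eapply IH; eauto.
    - exists x0; split; auto. intros y Ky. destruct (le_lt_dec (d x x0) (d x y)); auto.
      exfalso; apply N; exists y; subst; auto. }
  set (D := descends K x p).
  assert (DK : forall y, D y -> K y /\ d x y = d x p + d p y).
  { intros y Dy. assert (E : K y /\ exists n, d x y = d x p + n /\ walkn G y p n).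
    { induction Dy as [|y z Dz [Kz [n [En Wn]]] Ky A E].
      - split; auto. exists 0. split; [lia|constructor].
      - split; auto. exists (S n). split; [lia|econstructor; eauto]. }
    destruct E as [Ky [n [En Wn]]]. split; auto.
    apply (dist_le G HG) in Wn. pose proof (dist_tri G HG x p y). dist_lia. }
  (* Induction on a bound for the distances of both ends from [x]: QC settles a step down, and TC
     reduces a level step to a step down. *)
  assert (DC : forall m y z, D y -> K z -> adj y z -> d x y <= m -> d x z <= m -> D z).
  { induction m as [m IH] using lt_wf_ind.
    assert (Down : forall y z, D y -> K z -> adj y z -> d x y = m -> d x y = S (d x z) -> D z).
    { intros y z Dy Kz A Em E. destruct Dy as [|y y1 Dy1 Ky A1 E1].
      - pose proof (Min z Kz). lia.
      - destruct (classic (y1 = z)) as [<-|N]; auto.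
        destruct (wm_quadrangle G HG WM x y1 z y (d x z)) as [c [C1 [Cz Ec]]];
          auto using adj_sym; try lia.
        assert (Kc : K c) by (apply (KC c y1 z); auto; apply DK; auto).
        assert (Dc : D c).
        { apply (IH (d x y1) ltac:(lia) y1 c); auto using adj_sym; lia. }
        apply (descends_step K x p z c); auto using adj_sym. }
    intros y z Dy Kz A Ey Ez.
    pose proof (dist_adj G HG x y z A). pose proof (dist_adj G HG x z y (adj_sym _ _ _ A)).
    destruct (Nat.eq_dec (d x z) (S (d x y))) as [E|E].
    { apply (descends_step K x p z y); auto using adj_sym. }
    destruct (Nat.eq_dec (d x y) m) as [Em|Em].
    2: { apply (IH (d x y) ltac:(lia) y z); auto; lia. }
    destruct (Nat.eq_dec (d x y) (S (d x z))) as [E'|E'].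
    { apply (Down y z); auto. }
    destruct (d x y) as [|n] eqn:En.
    { assert (E0 : d x z = 0) by lia. apply dist0 in En, E0; auto. congruence. }
    destruct (wm_triangle G HG WM x y z n) as [c [Cy [Cz Ec]]]; auto; try lia.
    assert (Kc : K c).
    { apply (KC c y z); auto. apply DK; auto. adj_solve. }
    assert (Dc : D c) by (apply (Down y c); auto using adj_sym; lia).
    apply (descends_step K x p z c); auto using adj_sym. lia. }
  assert (DW : forall y z, walk_in G K y z -> D y -> D z).
  { induction 1 as [y Ky|y w z Ky A W IH]; auto. intro Dy.
    assert (Kw : K w) by (destruct W; auto).
    apply IH, (DC (max (d x y) (d x w)) y w); auto; lia. }
  exists p. split; auto. intros y Ky.
  apply DK, (DW p); auto. constructor.
Qed.

Lemma walk_in_snoc (P : G -> Prop) u v w : walk_in G P u v -> adj v w -> P w -> walk_in G P u w.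
Proof.
  induction 1; intros; econstructor; eauto. constructor; auto.
Qed.

Lemma walk_in_sym (P : G -> Prop) u v : walk_in G P u v -> walk_in G P v u.
Proof.
  induction 1; [constructor; auto|]. eapply walk_in_snoc; eauto using adj_sym.
Qed.

Lemma walk_in_trans (P : G -> Prop) u v w :
  walk_in G P u v -> walk_in G P v w -> walk_in G P u w.
Proof. induction 1; intros; auto. econstructor; eauto. Qed.

Lemma hull_connected u v y z : adj u v -> hull u v y -> hull u v z -> walk_in G (hull u v) y z.
Proof.
  intros A Hy Hz.
  assert (E : forall x, hull u v x -> walk_in G (hull u v) x u).
  { induction 1 as [| |x a b Ha IHa Hb IHb N Aa Ab].
    - constructor; constructor.
    - econstructor; [constructor|apply adj_sym; eauto|]. constructor; constructor.
    - apply walk_inS with a; auto. apply (hull_step _ _ _ x a b); auto. }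
  apply walk_in_trans with u; auto using walk_in_sym.
Qed.

Lemma hull_neighbor u v w : adj u v -> hull u v w -> exists z, hull u v z /\ adj w z.
Proof.
  intros A Hw. destruct Hw as [| |x a b Ha Hb N Aa Ab].
  - exists v. split; [constructor|auto].
  - exists u. split; [constructor|auto using adj_sym].
  - eauto.
Qed.

Lemma hull_gated u v : adj u v -> gated G (hull u v).
Proof.
  intro A. apply (closed2_gated _ u); auto using hull_l, hull_closed2, hull_connected.
Qed.

(** * Fibres of gate maps and parallel hulls *)

Context (noK : ~ has_induced K23 G) (noW : ~ has_induced W4minus G).

Definition fiber K w x := gate K x = w.

Lemma fiber_walk K w x : gated G K -> fiber K w x -> walk_in G (fiber K w) x w.
Proof.
  intro Gd. remember (d x w) as n eqn:En. revert x En.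
  induction n as [|n IH]; intros x En Fx.
  - symmetry in En. apply dist0 in En; auto. subst. constructor; auto.
  - destruct (dist_step G HG x w n) as [y [A E]]; auto.
    assert (Fy : fiber K w y).
    { unfold fiber in *. subst w. apply gate_interval; auto.
      apply dist1 in A; auto. lia. }
    econstructor; eauto.
Qed.

(** If [s] lay over [z <> w], QC from [w] would give [r] below [p] and [q], and QC from [z] would
    give [t] below [s] and [r]. Then [p], [q], [t] are common neighbours of [r] and [s], and [t] is
    adjacent to neither [p] nor [q]: a [W4minus] or a [K23]. *)
Lemma fiber_closed2 K w : gated G K -> closed2 (fiber K w).
Proof.
  intros Gd s p q Fp Fq Npq Sp Sq. unfold fiber in *.
  apply NNPP; intro Ns. set (z := gate K s) in *.
  destruct (gate_edge K s p Gd Sp) as [Azw Esp]; [rewrite ?Fp, ?Fq; exact Ns|].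
  destruct (gate_edge K s q Gd Sq) as [_ Esq]; [rewrite ?Fp, ?Fq; exact Ns|].
  rewrite Fp in Azw, Esp. rewrite Fq in Esq. fold z in Azw, Esp, Esq.
  assert (Kw : K w) by (rewrite <- Fp; apply gate_in; auto).
  assert (Kz : K z) by (apply gate_in; auto).
  pose proof (gate_dist K s w Gd Kw) as Dsw. fold z in Dsw.
  pose proof (gate_dist K p z Gd Kz) as Dpz. rewrite Fp in Dpz.
  pose proof (gate_dist K q z Gd Kz) as Dqz. rewrite Fq in Dqz.
  assert (D1 : d z w = 1) by (apply dist1; auto).
  destruct (wm_quadrangle G HG WM w p q s (d p w)) as [r [Rp [Rq Er]]];
    auto using adj_sym; try dist_lia.
  pose proof (dist_tri G HG z w r).
  pose proof (dist_adj G HG z r p Rp).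
  destruct (wm_quadrangle G HG WM z s r p (d p w)) as [t [Ts [Tr Et]]];
    auto using adj_sym; try dist_lia.
  { intros <-. dist_lia. }
  assert (Nrs : ~ adj r s).
  { intro A. pose proof (dist_adj G HG w r s A). dist_lia. }
  assert (Ers : r <> s) by (intros ->; dist_lia).
  assert (Ntp : ~ adj t p).
  { intro A. pose proof (dist_adj G HG z t p A). dist_lia. }
  assert (Ntq : ~ adj t q).
  { intro A. pose proof (dist_adj G HG z t q A). dist_lia. }
  assert (Etp : t <> p) by (intros ->; dist_lia).
  assert (Etq : t <> q) by (intros ->; dist_lia).
  destruct (classic (adj p q)) as [A|A].
  - apply Ntq, adj_sym.
    apply (W4minus_free G noW r p s t q); try adj_solve. constructor; adj_solve.
  - destruct (K23_free G noK r s p q t) as [B|[B|B]]; adj_solve.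
Qed.

Lemma fiber_gated K w : gated G K -> K w -> gated G (fiber K w).
Proof.
  intros Gd Kw. apply (closed2_gated _ w).
  - apply gate_id; auto.
  - apply fiber_closed2; auto.
  - intros. apply walk_in_trans with w; [|apply walk_in_sym]; apply fiber_walk; auto.
Qed.

(** Fibres are closed under two neighbours, so a gate map that collapses an edge collapses its whole
    hull. *)
Lemma gate_hull K x y z : gated G K -> gate K x = gate K y -> hull x y z -> gate K z = gate K x.
Proof.
  intros Gd E. apply (hull_min G x y (fiber K (gate K x))); auto using fiber_closed2.
  - reflexivity.
  - symmetry; auto.
Qed.

Definition boundary K w z x := gate K x = w /\ exists y, adj x y /\ gate K y = z.

(** The boundary consists of the points of one fibre that are fixed by going to the other fibre and
    back, so [mutual_gates_gated] applies. *)
Lemma boundary_gated K w z : gated G K -> K w -> K z -> adj w z -> gated G (boundary K w z).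
Proof.
  intros Gd Kw Kz A.
  assert (Nwz : w <> z) by adj_solve.
  pose proof (fiber_gated K w Gd Kw) as GA. pose proof (fiber_gated K z Gd Kz) as GB.
  assert (Fw : fiber K w w) by (apply gate_id; auto).
  assert (Fz : fiber K z z) by (apply gate_id; auto).
  assert (Sep : forall x y a b, fiber K a x -> fiber K b y -> a <> b ->
    gated G (fiber K b) -> adj x y -> gate (fiber K b) x = y).
  { intros x y a b Fx Fy N Gb Axy. apply gate_adj; auto. unfold fiber in *; congruence. }
  replace (boundary K w z)
    with (fun a => fiber K w a /\ gate (fiber K w) (gate (fiber K z) a) = a).
  { apply mutual_gates_gated; auto. }
  apply pred_ext. intro x. split.
  - intros [Fx E]. split; auto.
    exists (gate (fiber K z) x). split.
    + apply dist1; auto.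
      destruct (mutual_gates_isometry (fiber K w) (fiber K z) x w) as [_ I]; auto.
      * rewrite (Sep w z w z), (Sep z w z w); auto using adj_sym.
      * rewrite I, (Sep w z w z); auto. apply dist1; auto.
    + exact (gate_in (fiber K z) x GB).
  - intros [Fx [y [Axy Fy]]]. split; auto.
    rewrite (Sep x y w z), (Sep y x z w); auto using adj_sym.
Qed.

(* [hull x y] is a copy of [hull u v], with the gates as inverse isomorphisms. *)
Lemma parallel_hulls u v x y :
  adj u v -> adj x y -> gate (hull u v) x = u -> gate (hull u v) y = v ->
  (forall z, hull u v z -> gate (hull u v) (gate (hull x y) z) = z) /\
  gate (hull x y) u = x /\ gate (hull x y) v = y /\
  (forall z, hull x y z -> gate (hull x y) (gate (hull u v) z) = z).
Proof.
  intros Auv Axy Gx Gy.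
  set (H := hull u v) in *. set (H' := hull x y).
  assert (GH : gated G H) by (apply hull_gated; auto).
  assert (GH' : gated G H') by (apply hull_gated; auto).
  assert (Hu : H u) by constructor. assert (Hv : H v) by constructor.
  assert (Hx : H' x) by constructor. assert (Hy : H' y) by constructor.
  (* The points of [H] fixed by going to [H'] and back form a gated set that contains [u] and
     [v]. *)
  assert (P1 : forall z, H z -> gate H (gate H' z) = z).
  { intros z Hz.
    apply (hull_min G u v (fun a => H a /\ gate H (gate H' a) = a)); auto.
    - apply gated_closed2, mutual_gates_gated; auto.
    - split; auto. rewrite <- Gx. apply gate_gate_gate; auto.
    - split; auto. rewrite <- Gy. apply gate_gate_gate; auto. }
  destruct (mutual_gates_isometry H H' u v) as [I _]; auto.
  assert (Ag : adj (gate H' u) (gate H' v)).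
  { apply dist1; auto. rewrite I. apply dist1; auto. }
  (* Both [p] and [gate H' a] lie in the boundary [P]. The gate map of [P] collapses the edge [p q]
     to [p], hence also [H'], which contains [gate H' a]. *)
  assert (Side : forall u v x y, adj u v -> adj x y -> H u -> H v -> H' x -> H' y ->
    gate H x = u -> gate H y = v -> adj (gate H' u) (gate H' v) ->
    (forall z, H' z -> hull x y z) -> gate H' u = x).
  { clear - HG WM noK noW GH GH' P1.
    intros a b p q Aab Apq Ha Hb Hp Hq Gp Gq Ag Sub.
    set (P := boundary H a b).
    assert (GP : gated G P) by (apply boundary_gated; auto).
    assert (Pp : P p) by (split; eauto).
    assert (Pg : P (gate H' a)) by (split; eauto).
    assert (Nq : ~ P q) by (intros [E _]; rewrite Gq in E; rewrite E in Aab; adj_solve).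
    assert (E1 : gate P p = p) by (apply gate_id; auto).
    assert (E2 : gate P q = p) by (apply gate_adj; auto using adj_sym).
    rewrite <- (gate_id P (gate H' a)) by auto.
    rewrite (gate_hull P p q); auto; [congruence|].
    apply Sub, gate_in; auto. }
  assert (Eu : gate H' u = x) by (apply (Side u v x y); auto).
  assert (Ev : gate H' v = y).
  { apply (Side v u y x); auto using adj_sym.
    apply hull_min; auto using hull_closed2, hull_l, hull_r. }
  repeat split; auto.
  intros z Hz.
  apply (hull_min G x y (fun a => H' a /\ gate H' (gate H a) = a)); auto.
  - apply gated_closed2, mutual_gates_gated; auto.
  - split; auto. congruence.
  - split; auto. congruence.
Qed.

(** The gates [a], [b] of [u], [v] in [hull w z] differ, as otherwise the gate map would identify
    [w] and [z]. So [a b] and [u v] are parallel; since [a] and [b] already lie in [hull u v], they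
    equal [u] and [v]. *)
Lemma hull_eq u v w z :
  adj u v -> adj w z -> hull u v w -> hull u v z -> hull w z = hull u v.
Proof.
  intros Auv Awz Hw Hz.
  assert (Sub : forall x, hull w z x -> hull u v x).
  { apply hull_min; auto using hull_closed2. }
  apply pred_ext. intro x. split; auto. revert x.
  set (K := hull w z) in *.
  assert (GK : gated G K) by (apply hull_gated; auto).
  assert (Kw : K w) by constructor. assert (Kz : K z) by constructor.
  set (a := gate K u). set (b := gate K v).
  assert (Ka : K a) by (apply gate_in; auto). assert (Kb : K b) by (apply gate_in; auto).
  assert (Nab : a <> b).
  { intro E.
    pose proof (gate_hull K u v w GK E Hw) as E1. pose proof (gate_hull K u v z GK E Hz) as E2.
    rewrite gate_id in E1, E2 by auto.
    assert (E3 : w = z) by congruence; rewrite E3 in Awz; adj_solve. }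
  destruct (gate_edge K u v GK Auv Nab) as [Aab _]. fold a b in Aab.
  assert (GH : gated G (hull u v)) by (apply hull_gated; auto).
  assert (Gab : gated G (hull a b)) by (apply hull_gated; auto).
  assert (Sub' : forall x, hull a b x -> K x) by (apply hull_min; auto; apply hull_closed2).
  destruct (parallel_hulls a b u v Aab Auv) as [_ [Ea [Eb _]]].
  - apply gate_eq; auto. split; [constructor|]. intros y Hy. apply gate_dist; auto.
  - apply gate_eq; auto. split; [constructor|]. intros y Hy. apply gate_dist; auto.
  - rewrite gate_id in Ea, Eb by auto.
    apply hull_min; try congruence. apply hull_closed2.
Qed.

(** * Copies of a hull across its fibres *)

Section Decomposition.
Context (u v : G) (Auv : adj u v).
Let H := hull u v.

Let GH : gated G H.
Proof. apply hull_gated; auto. Qed.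

Let hull_gate_in x : H (gate H x).
Proof. apply gate_in; auto. Qed.

Lemma copy_hull x y : adj x y -> gate H x <> gate H y ->
  (forall z, H z -> gate H (gate (hull x y) z) = z) /\
  gate (hull x y) (gate H x) = x /\
  (forall z, hull x y z -> gate (hull x y) (gate H z) = z).
Proof.
  intros A N. destruct (gate_edge H x y GH A N) as [A' _].
  assert (E : hull (gate H x) (gate H y) = H) by (apply hull_eq; auto; apply hull_gate_in).
  destruct (parallel_hulls (gate H x) (gate H y) x y) as [P1 [P2 [_ P3]]];
    rewrite ?E in *; auto.
Qed.

Lemma copy_hull_adj x y w z : adj x y -> gate H x <> gate H y -> H w -> H z -> adj w z ->
  adj (gate (hull x y) w) (gate (hull x y) z).
Proof.
  intros A N Hw Hz Awz. destruct (copy_hull x y A N) as [P1 _].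
  destruct (mutual_gates_isometry H (hull x y) w z) as [I _]; auto using hull_gated.
  apply dist1; auto. rewrite I. apply dist1; auto.
Qed.

(** Let [p] be the copy of [w] and [q] the copy of a neighbour. The gate of [q] in the fibre over
    [w] is [p], so the gate map collapses the edge [p q] and with it the whole copy. *)
Lemma copy_hull_gate_fiber x y w z : adj x y -> gate H x <> gate H y -> H w ->
  hull x y z -> gate (fiber H w) z = gate (hull x y) w.
Proof.
  intros A N Hw Hz. destruct (copy_hull x y A N) as [P1 _].
  assert (GF : gated G (fiber H w)) by (apply fiber_gated; auto).
  assert (GC : gated G (hull x y)) by (apply hull_gated; auto).
  destruct (hull_neighbor u v w Auv Hw) as [t [Ht Awt]].
  set (p := gate (hull x y) w). set (q := gate (hull x y) t).
  assert (Apq : adj p q) by (apply copy_hull_adj; auto).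
  assert (Fp : fiber H w p) by (apply P1; auto).
  assert (Fq : ~ fiber H w q).
  { unfold fiber, q. rewrite P1 by auto. intros ->. adj_solve. }
  assert (Ep : gate (fiber H w) p = p) by (apply gate_id; auto).
  assert (Eq : gate (fiber H w) q = p) by (apply gate_adj; auto using adj_sym).
  rewrite <- Ep. apply (gate_hull (fiber H w) p q); auto; [congruence|].
  rewrite (hull_eq x y p q); auto; apply gate_in; auto.
Qed.

(** This is the set [U w] of the overview. *)
Definition inner_boundary w x := gate H x = w /\ exists y, adj x y /\ gate H y <> w.

(** An edge that leaves the fibre in any direction spans a copy of [H], and this copy contains an
    edge over [w z]. *)
Lemma inner_boundary_eq w z : H w -> H z -> adj w z -> inner_boundary w = boundary H w z.
Proof.
  intros Hw Hz A. apply pred_ext. intro x. split; intros [Ex [y [Axy Ey]]]; split; auto.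
  - subst w. assert (N : gate H x <> gate H y) by congruence.
    destruct (copy_hull x y Axy N) as [P1 [P2 _]].
    exists (gate (hull x y) z). split; auto.
    rewrite <- P2 at 1. apply copy_hull_adj; auto.
  - exists y; split; auto. rewrite Ey. intros ->. exact (adj_irrefl _ _ A).
Qed.

(** A geodesic that leaves the fibre over [w] meets the inner boundary. Hence the gate of a vertex
    of the fibre in the other part is its gate in the inner boundary. *)
Lemma inner_boundary_amalgam w x : H w -> gate H x = w -> ~ inner_boundary w x ->
  nontrivial_gated_amalgam G.
Proof.
  intros Hw Ex Nx.
  destruct (hull_neighbor u v w Auv Hw) as [z [Hz Awz]].
  assert (GB : gated G (inner_boundary w)).
  { rewrite (inner_boundary_eq w z) by auto. apply boundary_gated; auto. }
  assert (Bw : inner_boundary w w).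
  { split; [apply gate_id; auto|]. exists z. split; auto.
    rewrite gate_id by auto. adj_solve. }
  assert (Through : forall n a b, d a b = n -> gate H a = w -> gate H b <> w ->
    exists t, inner_boundary w t /\ d a t + d t b = n).
  { induction n as [|n IH]; intros a b E Ea Eb.
    - apply dist0 in E; auto. congruence.
    - destruct (dist_step G HG a b n E) as [c [Aac Ec]].
      destruct (classic (gate H c = w)) as [Fc|Fc].
      + destruct (IH c b Ec Fc Eb) as [t [Bt Et]]. exists t. split; auto.
        pose proof (dist_tri G HG a c t). pose proof (dist_tri G HG a t b).
        apply dist1 in Aac; auto. lia.
      + exists a. split; [split; eauto|]. rewrite dist_refl; auto. }
  (* The implication encodes the union of the inner boundary with the complement of the fibre. *)
  exists (fiber H w), (fun y => gate H y = w -> inner_boundary w y).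
  split; [apply fiber_gated; auto|]. split; [|split; [|split; [|split]]].
  - apply is_gate_gated. intro a.
    destruct (classic (gate H a = w -> inner_boundary w a)) as [Ha|Ha].
    { exists a. split; auto. intros. rewrite dist_refl; auto. }
    exists (gate (inner_boundary w) a). split.
    { intros _. apply gate_in; auto. }
    intros b Hb. apply imply_to_and in Ha. destruct Ha as [Ea Na].
    destruct (classic (gate H b = w)) as [Eb|Eb]; [apply gate_dist; auto|].
    destruct (Through _ a b eq_refl Ea Eb) as [t [Bt Et]].
    pose proof (gate_dist (inner_boundary w) a t GB Bt).
    pose proof (dist_tri G HG a (gate (inner_boundary w) a) b).
    pose proof (dist_tri G HG (gate (inner_boundary w) a) t b). lia.
  - exists w. split; [apply gate_id; auto|auto].
  - intro a. destruct (classic (gate H a = w)); [left|right]; auto. intro; contradiction.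
  - exists z. unfold fiber. rewrite gate_id by auto. intros ->. apply (adj_irrefl _ w Awz).
  - exists x. auto.
Qed.

(** * Product coordinates when every vertex has a neighbour in another fibre *)

Context (Full : forall x, exists y, adj x y /\ gate H x <> gate H y).

Let P := fiber H u.

Let Hu : H u.
Proof. constructor. Qed.

Let GP : gated G P.
Proof. apply fiber_gated; auto. Qed.

(** Both copies have the same vertex [p] over [u]. If their vertices over [v] differed, [p] would
    have two neighbours in the fibre over [v] and would belong to it. So the copies share an edge,
    and [hull_eq] applies. *)
Lemma copy_hull_unique x y x' y' : adj x y -> gate H x <> gate H y ->
  adj x' y' -> gate H x' <> gate H y' -> gate P x = gate P x' -> hull x y = hull x' y'.
Proof.
  intros A N A' N' E.
  assert (Hv : H v) by constructor.
  destruct (copy_hull x y A N) as [P1 _]. destruct (copy_hull x' y' A' N') as [P1' _].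
  pose proof (hull_gated x y A) as GC. pose proof (hull_gated x' y' A') as GC'.
  unfold P in E. rewrite (copy_hull_gate_fiber x y u x), (copy_hull_gate_fiber x' y' u x') in E
    by (auto; constructor).
  set (p := gate (hull x y) u) in *.
  assert (E1 : gate (hull x y) v = gate (hull x' y') v).
  { apply NNPP; intro Nq.
    assert (F : fiber H v p).
    { apply (fiber_closed2 H v GH p (gate (hull x y) v) (gate (hull x' y') v)); auto;
        try (apply P1; auto); try (apply P1'; auto).
      - apply copy_hull_adj; auto.
      - rewrite E. apply copy_hull_adj; auto. }
    unfold fiber, p in F. rewrite P1 in F by auto. revert Auv. rewrite F. apply adj_irrefl. }
  set (q := gate (hull x y) v) in *.
  assert (Apq : adj p q) by (apply copy_hull_adj; auto).
  transitivity (hull p q).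
  - symmetry. apply hull_eq; auto; [exact (gate_in _ u GC)|exact (gate_in _ v GC)].
  - apply hull_eq; auto.
    + rewrite E. exact (gate_in _ u GC').
    + rewrite E1. exact (gate_in _ v GC').
Qed.

Lemma coordinates_adj x x' : adj (gate H x) (gate H x') -> gate P x = gate P x' -> adj x x'.
Proof.
  intros A E. destruct (Full x) as [y [Axy N]]. destruct (Full x') as [y' [Axy' N']].
  pose proof (copy_hull_unique x y x' y' Axy N Axy' N' E) as EH.
  destruct (copy_hull x y Axy N) as [_ [P2 _]].
  destruct (copy_hull x' y' Axy' N') as [_ [P2' _]].
  rewrite <- EH in P2'. rewrite <- P2, <- P2'. apply copy_hull_adj; auto.
Qed.

Lemma coordinates_inj x x' : gate H x = gate H x' -> gate P x = gate P x' -> x = x'.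
Proof.
  intros EH EP. destruct (Full x) as [y [Axy N]]. destruct (Full x') as [y' [Axy' N']].
  pose proof (copy_hull_unique x y x' y' Axy N Axy' N' EP) as E.
  destruct (copy_hull x y Axy N) as [_ [P2 _]].
  destruct (copy_hull x' y' Axy' N') as [_ [P2' _]]. congruence.
Qed.

Lemma coordinates_surj w p : H w -> P p -> exists x, gate H x = w /\ gate P x = p.
Proof.
  intros Hw Pp. destruct (Full p) as [y [A N]].
  destruct (copy_hull p y A N) as [P1 [P2 _]].
  exists (gate (hull p y) w). split; auto.
  unfold P. rewrite (copy_hull_gate_fiber p y) by (auto; apply gate_in, hull_gated; auto).
  transitivity (gate (hull p y) (gate H p)); [f_equal; symmetry; exact Pp|exact P2].
Qed.

Lemma coordinates_adj_fiber x x' :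
  gate H x = gate H x' -> adj (gate P x) (gate P x') -> adj x x'.
Proof.
  intros E A. set (w := gate H x).
  assert (GF : gated G (fiber H w)) by (apply fiber_gated; auto; apply hull_gate_in).
  (* Inside the copy of [H] through [t], going to the fibre over [u] and back is the identity.
     Adjacency then returns from [P] through [gate_edge]. *)
  assert (Back : forall t, gate H t = w -> gate (fiber H w) (gate P t) = t).
  { intros t Et. destruct (Full t) as [y [Aty N]].
    destruct (copy_hull t y Aty N) as [P1 [P2 _]].
    unfold P. rewrite (copy_hull_gate_fiber t y u t) by (auto; constructor).
    rewrite (copy_hull_gate_fiber t y w).
    - congruence.
    - auto.
    - auto.
    - apply hull_gate_in.
    - apply gate_in, hull_gated; auto. }
  rewrite <- (Back x), <- (Back x') by (auto; symmetry; auto).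
  apply gate_edge; auto. rewrite !Back by (auto; symmetry; auto).
  intros ->. adj_solve.
Qed.

Lemma coordinates_adj_inv x x' : adj x x' ->
  (adj (gate H x) (gate H x') /\ gate P x = gate P x') \/
  (gate H x = gate H x' /\ adj (gate P x) (gate P x')).
Proof.
  intro A. destruct (classic (gate H x = gate H x')) as [E|N].
  - right. split; auto. apply gate_edge; auto.
    intro E'. pose proof (coordinates_inj x x' E E'). subst. adj_solve.
  - left. split; [apply gate_edge; auto|].
    unfold P. rewrite !(copy_hull_gate_fiber x x') by (auto; constructor). reflexivity.
Qed.

End Decomposition.

(** * The product of a hull and a fibre *)

Definition subgraph (K : G -> Prop) : graph.
Proof.
  refine (@Graph {x | K x} (fun a b : {x | K x} => adj (proj1_sig a) (proj1_sig b)) _ _).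
  - intros a b. apply adj_sym.
  - intros a. apply adj_irrefl.
Defined.

Lemma sig_eq (K : G -> Prop) (a b : {x | K x}) : proj1_sig a = proj1_sig b -> a = b.
Proof.
  destruct a as [a Ka], b as [b Kb]; simpl. intros <-. f_equal. apply proof_irrelevance.
Qed.

Lemma subgraph_connected (K : G -> Prop) :
  (forall x y, K x -> K y -> walk_in G K x y) -> connected (subgraph K).
Proof.
  intros C [x Kx] [y Ky]. specialize (C x y Kx Ky). revert Kx Ky.
  induction C as [x Kx'|x w y Kx' A W IH]; intros Kx Ky.
  - exists 0. rewrite (proof_irrelevance _ Kx Ky). constructor.
  - assert (Kw : K w) by (destruct W; auto).
    destruct (IH Kw Ky) as [n Wn]. exists (S n).
    apply (walknS (subgraph K) _ (exist K w Kw)); auto.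
Qed.

Lemma product_decomposition u v x0 : adj u v -> ~ hull u v x0 ->
  (forall x, exists y, adj x y /\ gate (hull u v) x <> gate (hull u v) y) ->
  nontrivial_product G.
Proof.
  intros A N0 Full. set (H := hull u v). set (P := fiber H u).
  assert (GH : gated G H) by (apply hull_gated; auto).
  assert (Hu : H u) by constructor.
  assert (GP : gated G P) by (apply fiber_gated; auto).
  exists (subgraph H), (subgraph P).
  split; [apply subgraph_connected; intros; apply hull_connected; auto|].
  split; [|split; [|split]].
  - apply subgraph_connected. intros x y Px Py.
    apply walk_in_trans with u; [|apply walk_in_sym]; apply fiber_walk; auto.
  - exists (exist H u Hu), (exist H v (hull_r _ _ _)). 
    intro E. injection E as E. apply (adj_irrefl _ u). rewrite E at 2. exact A.
  (* The vertex [x0] and its gate in [H] have the same first coordinate and are distinct, so their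
     coordinates in the fibre differ. *)
  - exists (exist P _ (gate_in P x0 GP)), (exist P _ (gate_in P (gate H x0) GP)).
    intro E. injection E as E. apply N0.
    rewrite (coordinates_inj u v A Full x0 (gate H x0)).
    + apply gate_in; auto.
    + symmetry. apply (gate_id H); auto. apply gate_in; auto.
    + exact E.
  - set (R := fun (c : cartprod (subgraph H) (subgraph P)) x =>
      gate H x = proj1_sig (fst c) /\ gate P x = proj1_sig (snd c)).
    assert (RS : forall c, R c (epsilon (inhabits u) (R c))).
    { intro c. apply epsilon_spec. destruct c as [[w Hw] [p Pp]]. unfold R. simpl.
      apply coordinates_surj; auto. }
    exists (fun c => epsilon (inhabits u) (R c)).
    exists (fun x => (exist H _ (gate_in H x GH), exist P _ (gate_in P x GP))).
    split; [|split].
    + intros c. destruct (RS c) as [R1 R2]. destruct c as [a b]; simpl in *.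
      f_equal; apply sig_eq; auto.
    + intro x. set (c := (exist H _ (gate_in H x GH), exist P _ (gate_in P x GP))
        : cartprod (subgraph H) (subgraph P)).
      destruct (RS c) as [R1 R2]. apply (coordinates_inj u v A Full); auto.
    + intros c c'. destruct (RS c) as [R1 R2], (RS c') as [R1' R2'].
      set (x := epsilon (inhabits u) (R c)) in *. set (x' := epsilon (inhabits u) (R c')) in *.
      split.
      * intro Axx. destruct (coordinates_adj_inv u v A Full x x' Axx) as [[B E]|[E B]].
        -- left. split; [|apply sig_eq; exact (eq_trans (eq_sym R2) (eq_trans E R2'))].
           change (adj (proj1_sig (fst c)) (proj1_sig (fst c'))).
           rewrite <- R1, <- R1'. exact B.
        -- right. split; [apply sig_eq; exact (eq_trans (eq_sym R1) (eq_trans E R1'))|].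
           change (adj (proj1_sig (snd c)) (proj1_sig (snd c'))).
           rewrite <- R2, <- R2'. exact B.
      * intros [[B E]|[E B]].
        -- apply (coordinates_adj u v A Full).
           ++ change (adj (proj1_sig (fst c)) (proj1_sig (fst c'))) in B.
              rewrite <- R1, <- R1' in B. exact B.
           ++ exact (eq_trans R2 (eq_trans (f_equal (@proj1_sig _ _) E) (eq_sym R2'))).
        -- apply (coordinates_adj_fiber u v A Full).
           ++ exact (eq_trans R1 (eq_trans (f_equal (@proj1_sig _ _) E) (eq_sym R1'))).
           ++ change (adj (proj1_sig (snd c)) (proj1_sig (snd c'))) in B.
              rewrite <- R2, <- R2' in B. exact B.
Qed.

Lemma prime_elementary : prime G -> elementary G.
Proof.
  intros [H2 [NP NA]]. split; auto. intros u v x A. apply NNPP; intro N.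
  apply NP, (product_decomposition u v x); auto.
  intro y. apply NNPP; intro Ny.
  apply NA, (inner_boundary_amalgam u v A (gate (hull u v) y) y); auto.
  - apply gate_in, hull_gated; auto.
  - intros [_ [z [Ayz Nz]]]. apply Ny. exists z. split; auto.
Qed.

End Gates.

(** * Balls of the universal cover *)

(** The quotient is realised by chosen representatives. Transitivity is asked on [Z], where
    [same_lift_trans] provides it. *)
Lemma quotient (A : Type) (Z : A -> Prop) (R : A -> A -> Prop) :
  (forall a, Z a -> R a a) -> (forall a b, R a b -> R b a) ->
  (forall a b c, Z a -> Z b -> Z c -> R a b -> R b c -> R a c) ->
  exists (W : Type) (rep : W -> A),
    (forall w, Z (rep w)) /\ (forall w w', R (rep w) (rep w') -> w = w') /\
    (forall a, Z a -> exists w, R (rep w) a).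
Proof.
  intros Rr Rs Rt.
  set (canon := fun a => epsilon (inhabits a) (fun b => Z b /\ R a b)).
  assert (CS : forall a, Z a -> Z (canon a) /\ R a (canon a)).
  { intros a Za. unfold canon. apply epsilon_spec. exists a. auto. }
  assert (CE : forall a b, Z a -> Z b -> R a b -> canon a = canon b).
  { intros a b Za Zb Rab. unfold canon.
    rewrite (proof_irrelevance _ (inhabits a) (inhabits b)). f_equal.
    apply pred_ext. intro c. split; intros [Zc Rc]; split; eauto. }
  exists {a | Z a /\ canon a = a}, (@proj1_sig _ _).
  split; [|split].
  - intros [a [Za Ea]]; auto.
  - intros [a [Za Ea]] [b [Zb Eb]]; simpl. intro Rab.
    assert (E : a = b) by (rewrite <- Ea, <- Eb; auto).
    revert Zb Eb. subst b. intros Zb Eb. f_equal. apply proof_irrelevance.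
  - intros a Za. destruct (CS a Za) as [Zc Rc].
    assert (Ec : canon (canon a) = canon a) by (symmetry; auto).
    exists (exist _ (canon a) (conj Zc Ec)). auto.
Qed.

(* The ball of radius [n] of the universal cover of the triangle-square complex, based over [v0]. *)
Record stage (G : graph) (v0 : G) (n : nat) := Stage {
  st :> Type;
  st_lvl : st -> nat;
  st_f : st -> G;
  st_adj : st -> st -> Prop;
  st_root : st;
  st_sym : forall x y, st_adj x y -> st_adj y x;
  st_hom : forall x y, st_adj x y -> adj (st_f x) (st_f y);
  st_lvl_le : forall x, st_lvl x <= n;
  st_lvl_adj : forall x y, st_adj x y -> st_lvl y <= S (st_lvl x);
  st_root_lvl : forall x, st_lvl x = 0 <-> x = st_root;
  st_root_f : st_f st_root = v0;
  st_parent : forall x k, st_lvl x = S k -> exists p, st_adj p x /\ st_lvl p = k;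
  st_inj : forall x y y', st_adj x y -> st_adj x y' -> st_f y = st_f y' -> y = y';
  st_tri : forall x y y', st_adj x y -> st_adj x y' -> adj (st_f y) (st_f y') -> st_adj y y';
  st_surj : forall x g, st_lvl x < n -> adj (st_f x) g -> exists y, st_adj x y /\ st_f y = g;
  st_sq_inner : forall a b c d, st_lvl a < n -> st_lvl b < n -> st_adj a b ->
    st_adj a d -> st_adj b c -> adj (st_f d) (st_f c) -> st_adj d c;
  st_par : forall y p p', st_adj p y -> st_adj p' y -> S (st_lvl p) = st_lvl y ->
    S (st_lvl p') = st_lvl y -> p <> p' ->
    exists c, st_adj c p /\ st_adj c p' /\ S (st_lvl c) = st_lvl p;
  st_hor : forall y y', st_adj y y' -> st_lvl y = st_lvl y' ->
    exists c, st_adj c y /\ st_adj c y' /\ S (st_lvl c) = st_lvl y }.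

Arguments st_lvl {G v0 n s}.
Arguments st_f {G v0 n s}.
Arguments st_adj {G v0 n s}.
Arguments st_root {G v0 n s}.
Arguments st_sym {G v0 n s}.
Arguments st_hom {G v0 n s}.
Arguments st_lvl_le {G v0 n s}.
Arguments st_lvl_adj {G v0 n s}.
Arguments st_root_lvl {G v0 n s}.
Arguments st_root_f {G v0 n s}.
Arguments st_parent {G v0 n s}.
Arguments st_inj {G v0 n s}.
Arguments st_tri {G v0 n s}.
Arguments st_surj {G v0 n s}.
Arguments st_sq_inner {G v0 n s}.
Arguments st_par {G v0 n s}.
Arguments st_hor {G v0 n s}.

Section Cover.
Context (G : graph) (HG : connected G).
Context (LTC : local_triangle_condition G) (LQC : local_quadrangle_condition G).
Context (noK : ~ has_induced K23 G).
Context (v0 : G).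

Local Notation ltc := (local_triangle_adj G HG LTC).
Local Notation lqc := (local_quadrangle_adj G HG LQC).

Lemma stage_zero : inhabited (stage G v0 0).
Proof.
  constructor.
  refine (Stage G v0 0 unit (fun _ => 0) (fun _ => v0) (fun _ _ => False) tt
    _ _ _ _ _ _ _ _ _ _ _ _ _); try tauto; try lia; try discriminate.
  - intros []; tauto.
Qed.

(** * Lifting squares in a ball *)

Section Step.
Context (n : nat) (S0 : stage G v0 n).
Implicit Types a b c d e p q x y : S0.
Local Notation f := (@st_f G v0 n S0).
Local Notation A := (@st_adj G v0 n S0).
Local Notation lvl := (@st_lvl G v0 n S0).

Lemma st_nadj_of_lvl x a b : A x a -> A x b -> S (lvl a) < lvl b -> f a <> f b /\ ~ adj (f a) (f b).
Proof.
  intros Ha Hb L. split.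
  - intro E. pose proof (st_inj _ _ _ Ha Hb E). subst. lia.
  - intro E. pose proof (st_lvl_adj _ _ (st_tri _ _ _ Ha Hb E)). lia.
Qed.

(* Chords [ac] and [bd] reduce the lifting of a 4-cycle to [st_tri]. *)
Lemma st_sq_chords a b c d : A a b -> A a d -> A b c -> adj (f d) (f c) ->
  (square (f a) (f b) (f c) (f d) -> A d c) -> A d c.
Proof.
  intros Hab Had Hbc Hdc K.
  destruct (classic (f a = f c)) as [E|Eac].
  { rewrite <- (st_inj b a c); auto using st_sym. }
  destruct (classic (f b = f d)) as [E|Ebd].
  { rewrite <- (st_inj a b d); auto. }
  destruct (classic (adj (f a) (f c))) as [E|Nac].
  { apply (st_tri a); auto. apply (st_tri b); auto using st_sym. }
  destruct (classic (adj (f b) (f d))) as [E|Nbd].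
  { apply (st_tri b); auto. apply (st_tri a); auto. }
  apply K. constructor; auto using st_hom, adj_sym.
Qed.

(** If [d] is below the last sphere, the square is lifted across [a d] instead. If [c] is one level
    below the last sphere, a common lower neighbour of [a] and [c] yields a [K23]. Otherwise LTC
    based two levels below the last sphere gives a vertex adjacent to the images of [d] and [c]; its
    lift leaves two inner squares and a triangle. *)
Lemma st_sq_outward a b c d : S (lvl a) = n -> lvl b = n -> A a b -> A a d -> A b c ->
  adj (f d) (f c) -> A d c.
Proof.
  intros La Lb Hab Had Hbc Hdc. apply (st_sq_chords a b c d); auto. intros [].
  pose proof (st_lvl_le d). pose proof (st_lvl_le c).
  destruct (le_lt_dec n (lvl d)) as [Ld|Ld].
  2: { destruct (st_surj d (f c)) as [c' [Hdc' Ec]]; auto.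
    assert (A b c').
    { apply (st_sq_inner a d c' b); auto; try lia. rewrite Ec; auto. }
    rewrite <- (st_inj b c' c); auto. }
  pose proof (st_lvl_adj c b (st_sym _ _ Hbc)).
  destruct (Nat.eq_dec (S (lvl c)) n) as [Lc|Lc].
  - exfalso.
    destruct (st_par b a c) as [e [Hea [Hec Le]]]; auto using st_sym; try lia.
    { intros ->; auto. }
    destruct (st_nadj_of_lvl a e b); auto using st_sym; try lia.
    destruct (st_nadj_of_lvl a e d); auto using st_sym; try lia.
    pose proof (st_hom _ _ Hea). pose proof (st_hom _ _ Hec).
    destruct (K23_free G noK (f a) (f c) (f b) (f d) (f e)) as [K|[K|K]]; adj_solve.
  - destruct (st_hor b c) as [p [Hpb [Hpc Lp]]]; auto; try lia.
    assert (Nap : a <> p) by (intros ->; pose proof (st_hom _ _ Hpc); auto).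
    destruct (st_par b a p) as [e [Hea [Hep Le]]]; auto; try lia.
    destruct (st_nadj_of_lvl a e d); auto using st_sym; try lia.
    destruct (st_nadj_of_lvl p e c); auto using st_sym; try lia.
    pose proof (st_hom _ _ Hea). pose proof (st_hom _ _ Hep).
    pose proof (st_hom _ _ Hpc). pose proof (st_hom _ _ Had).
    destruct (ltc (f e) (f d) (f c) (f a) (f p)) as [x [Xe [Xd Xc]]]; auto.
    destruct (st_surj e x) as [X [HeX EX]]; auto using adj_sym; try lia.
    subst x. apply (st_tri X).
    + apply (st_sq_inner e a d X); auto; lia.
    + apply (st_sq_inner e p c X); auto; lia.
    + auto.
Qed.

(** When [a] and [b] both lie on the last sphere, their common parent [p], with LTC based at [f p]
    where required, reduces the claim to [st_sq_outward] and triangles. *)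
Lemma st_sq a b c d : A a b -> A a d -> A b c -> adj (f d) (f c) -> A d c.
Proof.
  intros Hab Had Hbc Hdc.
  pose proof (st_lvl_le a). pose proof (st_lvl_le b).
  pose proof (st_lvl_adj _ _ Hab). pose proof (st_lvl_adj _ _ (st_sym _ _ Hab)).
  destruct (Nat.eq_dec (lvl a) n) as [La|La], (Nat.eq_dec (lvl b) n) as [Lb|Lb].
  - destruct (st_hor a b) as [p [Hpa [Hpb Lp]]]; auto; try lia.
    destruct (classic (f p = f d)) as [E|Epd].
    { assert (p = d) by (apply (st_inj a); auto using st_sym). subst p.
      apply (st_tri b); auto using st_sym. }
    destruct (classic (f p = f c)) as [E|Epc].
    { assert (p = c) by (apply (st_inj b); auto using st_sym). subst p.
      apply st_sym, (st_tri a); auto using st_sym, adj_sym. }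
    destruct (classic (adj (f p) (f d))) as [E|Npd].
    { apply (st_sq_outward p b c d); auto; try lia.
      apply (st_tri a); auto using st_sym. }
    destruct (classic (adj (f p) (f c))) as [E|Npc].
    { apply st_sym, (st_sq_outward p a d c); auto using adj_sym; try lia.
      apply (st_tri b); auto using st_sym. }
    destruct (ltc (f p) (f d) (f c) (f a) (f b)) as [x [Xp [Xd Xc]]]; auto using st_hom.
    destruct (st_surj p x) as [X [HpX EX]]; auto using adj_sym; try lia.
    subst x. apply (st_tri X); auto.
    + apply (st_sq_outward p a d X); auto; lia.
    + apply (st_sq_outward p b c X); auto; lia.
  - apply st_sym, (st_sq_outward b a d c); auto using st_sym, adj_sym; lia.
  - apply (st_sq_outward a b c d); auto; lia.
  - apply (st_sq_inner a b c d); auto; lia.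
Qed.

(** * The vertices of the next sphere *)

Definition missing (t : S0 * G) : Prop :=
  lvl (fst t) = n /\ adj (f (fst t)) (snd t) /\
  forall x, A (fst t) x -> f x <> snd t.

Definition siblings p q := p = q \/ exists c, A c p /\ A c q /\ S (lvl c) = n.

Definition same_lift (t t' : S0 * G) : Prop := snd t = snd t' /\ siblings (fst t) (fst t').

Lemma siblings_sym p q : siblings p q -> siblings q p.
Proof. intros [->|[c [? [? ?]]]]; [left; auto|right; eauto]. Qed.

(** Otherwise [c] itself, or a lift of [y] at [c], would be a lift of [y] at [q]. *)
Lemma missing_parent q (y : G) c : missing (q, y) -> A c q -> S (lvl c) = n ->
  f c <> y /\ ~ adj (f c) y.
Proof.
  intros [Lq [Ay N]] Hc Lc; simpl in *. split.
  - apply N; auto using st_sym.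
  - intro E. destruct (st_surj c y) as [Y [HcY EY]]; auto; try lia.
    apply (N Y); auto. apply (st_tri c); auto. rewrite EY; auto.
Qed.

Lemma missing_sibling q q' (y : G) c : missing (q, y) -> A c q -> A c q' ->
  lvl q' = n -> adj (f q') y -> missing (q', y).
Proof.
  intros [Lq [Ay N]] Hc Hc' Lq' Ay'; simpl in *. repeat split; auto; simpl.
  intros x Hx E. apply (N x); auto.
  apply (st_sq c q' x q); auto. rewrite E; auto.
Qed.

(** The parents [c1], [c2] of the two pairs have a common neighbour [e] one level lower. By [K], a
    vertex adjacent to the images of [e], [q1] and [q3] lifts to a common parent of [q1] and [q3];
    LTC or LQC based at [f e] supplies one. *)
Lemma same_lift_trans t1 t2 t3 : missing t1 -> missing t2 -> missing t3 ->
  same_lift t1 t2 -> same_lift t2 t3 -> same_lift t1 t3.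
Proof.
  destruct t1 as [q1 y], t2 as [q2 y2], t3 as [q3 y3].
  intros M1 M2 M3 [Ey S12] [Ey' S23]; simpl in *; subst y2 y3.
  split; auto; simpl.
  destruct S12 as [->|[c1 [H11 [H12 L1]]]]; auto.
  destruct S23 as [<-|[c2 [H22 [H23 L2]]]]; [right; eauto|].
  destruct (classic (c1 = c2)) as [<-|Nc]; [right; eauto|].
  pose proof (proj1 M1) as Lq1. pose proof (proj1 M2) as Lq2. pose proof (proj1 M3) as Lq3.
  simpl in *.
  destruct (st_par q2 c1 c2) as [e [He1 [He2 Le]]]; auto; try lia.
  destruct (missing_parent q1 y c1) as [Ec1 Nc1]; auto.
  destruct (missing_parent q3 y c2) as [Ec2 Nc2]; auto.
  destruct (st_nadj_of_lvl c1 e q1); auto using st_sym; try lia.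
  destruct (st_nadj_of_lvl c2 e q3); auto using st_sym; try lia.
  destruct M1 as [_ [A1 N1]]. destruct M3 as [_ [A3 N3]]. simpl in *.
  assert (Ney : ~ adj (f e) y).
  { intro E. destruct (st_surj e y) as [Y [HeY EY]]; auto; try lia.
    apply (N1 Y); auto. apply st_sym, (st_sq e c1 q1 Y); auto. rewrite EY. auto using adj_sym. }
  assert (Eey : f e <> y).
  { intros <-. apply Nc1. auto using st_hom, st_sym. }
  assert (K : forall x : G, adj x (f e) -> adj x (f q1) -> adj x (f q3) -> siblings q1 q3).
  { intros x Xe X1 X3. destruct (st_surj e x) as [X [HeX EX]]; auto using adj_sym; try lia.
    subst x.
    assert (B1 : A X q1) by (apply (st_sq e c1 q1 X); auto).
    assert (B3 : A X q3) by (apply (st_sq e c2 q3 X); auto).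
    right. exists X. repeat split; auto.
    pose proof (st_lvl_adj _ _ HeX). pose proof (st_lvl_adj _ _ B1). lia. }
  destruct (classic (f q1 = f q3)) as [E|E13].
  { left. apply (st_inj c2); auto.
    apply (st_sq e c1 q1 c2); auto. rewrite E. auto using st_hom. }
  destruct (classic (adj (f q1) (f q3))) as [E|N13].
  { destruct (ltc (f e) (f q1) (f q3) (f c1) (f c2)) as [x [Xe [X1 X3]]];
      auto using st_hom. eauto. }
  destruct (lqc (f e) (f q1) (f q3) y (f c1) (f c2)) as [[t [Te Ty]]|[x [Xe [X1 X3]]]];
    auto using st_hom, adj_sym; [|eauto].
  (* The other outcome of LQC is a common neighbour of [f e] and [y]; through LTC it would produce a
     lift of [y] at [q1]. *)
  exfalso.
  destruct (ltc y (f e) (f c1) t (f q1)) as [x [Xy [Xe Xc]]];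
    auto using st_hom, adj_sym, st_sym.
  destruct (st_surj e x) as [X [HeX EX]]; auto using adj_sym; try lia.
  subst x. pose proof (st_lvl_adj _ _ HeX).
  assert (HX1 : A X c1) by (apply (st_tri e); auto).
  destruct (st_surj X y) as [Y [HXY EY]]; auto; try lia.
  apply (N1 Y); auto. apply (st_sq c1 X Y q1); auto using st_sym. rewrite EY; auto.
Qed.

Section Extension.
Context (W : Type) (rep : W -> S0 * G).
Context (rep_missing : forall w, missing (rep w)).
Context (rep_inj : forall w w', same_lift (rep w) (rep w') -> w = w').
Context (rep_surj : forall t, missing t -> exists w, same_lift (rep w) t).
Implicit Types w : W.

Let g w : G := snd (rep w).
(** The parents of the new vertex [w]: the vertices of the last sphere that define the same lift as
    its representative. *)
Let M w q : Prop := missing (q, g w) /\ siblings (fst (rep w)) q.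

Let M_missing w q : M w q -> missing (q, g w).
Proof. intros [H _]; exact H. Qed.

Let M_lvl w q : M w q -> lvl q = n.
Proof. intros [[H _] _]; exact H. Qed.

Let M_adj w q : M w q -> adj (f q) (g w).
Proof. intros [[_ [H _]] _]; exact H. Qed.

Let M_new w q x : M w q -> A q x -> f x <> g w.
Proof. intros [[_ [_ H]] _]; apply H. Qed.

Let M_ex w : exists q, M w q.
Proof.
  exists (fst (rep w)). split; [|left; auto].
  pose proof (rep_missing w) as R. unfold g. destruct (rep w); exact R.
Qed.

Let rep_missing' w : missing (fst (rep w), g w).
Proof. pose proof (rep_missing w) as R. unfold g. destruct (rep w); exact R. Qed.

Let M_sib w p q : M w p -> M w q -> siblings p q.
Proof.
  intros [Mp Sp] [Mq Sq].
  destruct (same_lift_trans (p, g w) (fst (rep w), g w) (q, g w)); auto.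
  - split; auto. apply siblings_sym; auto.
  - split; auto.
Qed.

Let M_lift (y : G) q : missing (q, y) -> exists w, g w = y /\ M w q.
Proof.
  intro Mq. destruct (rep_surj (q, y) Mq) as [w [E S]]; simpl in *.
  exists w. split; auto. split; auto. unfold g. rewrite E. auto.
Qed.

Let M_eq w w' p q : M w p -> M w' q -> g w = g w' -> siblings p q -> w = w'.
Proof.
  intros [Mp Sp] [Mq Sq] E S. apply rep_inj. split; auto.
  destruct (same_lift_trans (fst (rep w), g w) (p, g w) (q, g w)) as [_ S1]; auto;
    try (split; auto; fail); try (rewrite E; auto; fail).
  destruct (same_lift_trans (fst (rep w), g w) (q, g w) (fst (rep w'), g w)) as [_ S2]; auto;
    try (split; auto; fail); try (rewrite E; auto; fail).
  split; auto. apply siblings_sym; auto.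
Qed.

Let M_trans w p q c : M w p -> A c p -> A c q -> lvl q = n -> S (lvl c) = n ->
  adj (f q) (g w) -> M w q.
Proof.
  intros Mp Hp Hq Lq Lc Aq. pose proof Mp as [Mp1 Sp].
  assert (Mq : missing (q, g w)) by (eapply missing_sibling; eauto).
  split; auto.
  destruct (same_lift_trans (fst (rep w), g w) (p, g w) (q, g w)) as [_ S1]; auto.
  - split; auto.
  - split; auto. right; eauto.
Qed.

(** Adjacent new vertices are required to share a parent, which makes [st_hor] hold. *)
Definition ext_adj (s t : S0 + W) : Prop :=
  match s, t with
  | inl x, inl y => A x y
  | inl x, inr w | inr w, inl x => M w x
  | inr w, inr w' => adj (g w) (g w') /\ exists q, M w q /\ M w' q
  end.
Definition ext_f (s : S0 + W) : G := match s with inl x => f x | inr w => g w end.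
Definition ext_lvl (s : S0 + W) : nat := match s with inl x => lvl x | inr _ => S n end.

Lemma ext_sym s t : ext_adj s t -> ext_adj t s.
Proof.
  destruct s, t; simpl; auto using st_sym.
  intros [? [q []]]; eauto using adj_sym.
Qed.

Lemma ext_inj s t t' : ext_adj s t -> ext_adj s t' -> ext_f t = ext_f t' -> t = t'.
Proof.
  destruct s as [x|w], t as [y|w1], t' as [y'|w2]; simpl; intros H1 H2 E.
  - f_equal. eapply st_inj; eauto.
  - exfalso. eapply M_new; eauto.
  - exfalso. eapply M_new; eauto.
  - f_equal. apply (M_eq w1 w2 x x); auto. left; auto.
  - f_equal. destruct (M_sib w y y' H1 H2) as [|[c [? [? ?]]]]; auto.
    eapply st_inj; eauto.
  - exfalso. destruct H2 as [_ [q [Mq Mq2]]].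
    pose proof (M_adj _ _ Mq2) as Aq.
    destruct (M_sib w y q H1 Mq) as [->|[c [Hy [Hq Lc]]]].
    + rewrite <- E in Aq. adj_solve.
    + apply (M_new w2 q y Mq2); auto. apply (st_tri c); auto. rewrite E; auto.
  - exfalso. destruct H1 as [_ [q [Mq Mq2]]].
    pose proof (M_adj _ _ Mq2) as Aq.
    destruct (M_sib w y' q H2 Mq) as [->|[c [Hy [Hq Lc]]]].
    + rewrite E in Aq. adj_solve.
    + apply (M_new w1 q y' Mq2); auto. apply (st_tri c); auto. rewrite <- E; auto.
  - f_equal. destruct H1 as [_ [q1 [Mq1 M1]]]. destruct H2 as [_ [q2 [Mq2 M2]]].
    eapply M_eq; eauto.
Qed.

(** The vertex [y] is on the last sphere, since at a lower level [g w] would be lifted at [y] and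
    hence at [x]. *)
Let tri_old_new x y w : M w x -> A x y -> adj (f y) (g w) -> M w y.
Proof.
  intros Mx Hxy Ayw. pose proof (M_lvl _ _ Mx) as Lx.
  pose proof (st_lvl_le y). destruct (Nat.eq_dec (lvl y) n) as [Ly|Ly].
  - destruct (st_hor x y) as [c [Hcx [Hcy Lc]]]; auto; try lia.
    apply (M_trans w x y c); auto; lia.
  - exfalso. destruct (st_surj y (g w)) as [X [HyX EX]]; auto; try lia.
    apply (M_new w x X Mx); auto. apply (st_tri y); auto using st_sym.
    rewrite EX; auto.
Qed.

Let tri_new w w' x : ext_adj (inr w) (inr w') -> M w x -> adj (f x) (g w') -> M w' x.
Proof.
  intros [_ [q [Mq Mq']]] Mx A'.
  destruct (M_sib w x q Mx Mq) as [->|[c [Hx [Hq Lc]]]]; auto.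
  apply (M_trans w' q x c); auto. eauto.
Qed.

(** LTC based at [f p] gives a vertex adjacent to both images. Its lift at [p] is on the last
    sphere, as otherwise [g w1] would have a lift at [q1], so it is a sibling of [q1] and [q2]. *)
Let new_corner w1 w2 p q1 q2 : S (lvl p) = n -> A p q1 -> A p q2 -> M w1 q1 -> M w2 q2 ->
  adj (g w1) (g w2) -> exists q, M w1 q /\ M w2 q.
Proof.
  intros Lp H1 H2 M1 M2 A12.
  destruct (missing_parent q1 (g w1) p) as [? ?]; auto.
  destruct (missing_parent q2 (g w2) p) as [? ?]; auto.
  destruct (ltc (f p) (g w1) (g w2) (f q1) (f q2)) as [x [Xp [X1 X2]]]; auto using st_hom.
  destruct (st_surj p x) as [X [HpX EX]]; auto using adj_sym; try lia.
  subst x. exists X.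
  assert (LX : lvl X = n).
  { pose proof (st_lvl_le X). destruct (Nat.eq_dec (lvl X) n); auto. exfalso.
    destruct (st_surj X (g w1)) as [Y [HXY EY]]; auto; try lia.
    apply (M_new w1 q1 Y M1); auto.
    apply (st_sq p X Y q1); auto. rewrite EY; auto using adj_sym. }
  split; [apply (M_trans w1 q1 X p)|apply (M_trans w2 q2 X p)]; auto.
Qed.

Lemma ext_tri s t t' : ext_adj s t -> ext_adj s t' -> adj (ext_f t) (ext_f t') -> ext_adj t t'.
Proof.
  destruct s as [x|w], t as [y|w1], t' as [y'|w2]; simpl; intros H1 H2 E.
  - eapply st_tri; eauto.
  - eapply tri_old_new; eauto.
  - eapply tri_old_new; eauto using adj_sym.
  - eauto.
  - destruct (M_sib w y y' H1 H2) as [->|[c [? [? ?]]]]; [adj_solve|].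
    eapply st_tri; eauto.
  - apply (tri_new w w2 y); auto.
  - apply (tri_new w w1 y'); auto using adj_sym.
  - split; auto. destruct H1 as [_ [q1 [Mq1 M1]]]. destruct H2 as [_ [q2 [Mq2 M2]]].
    destruct (M_sib w q1 q2 Mq1 Mq2) as [->|[c [Hc1 [Hc2 Lc]]]]; auto; eauto.
Qed.

Let sq_outward_new a b d w : S (lvl a) = n -> A a b -> A a d -> M w b ->
  adj (f d) (g w) -> M w d.
Proof.
  intros La Hab Had Mb Adw. pose proof (M_lvl _ _ Mb) as Lb. pose proof (st_lvl_le d).
  destruct (Nat.eq_dec (lvl d) n) as [Ld|Ld].
  - apply (M_trans w b d a); auto.
  - exfalso. destruct (st_surj d (g w)) as [X [HdX EX]]; auto; try lia.
    apply (M_new w b X Mb); auto. apply (st_sq a d X b); auto.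
    rewrite EX. auto using adj_sym.
Qed.

(** If [a] is on the last sphere, the square is rerouted through the common parent [p] of [a] and
    [b], as in [st_sq]. *)
Let sq_new a b d w : A a b -> A a d -> M w b -> adj (f d) (g w) -> M w d.
Proof.
  intros Hab Had Mb Adw. pose proof (M_lvl _ _ Mb) as Lb.
  pose proof (st_lvl_le a). pose proof (st_lvl_adj _ _ Hab).
  destruct (Nat.eq_dec (lvl a) n) as [La|La].
  2: { apply (sq_outward_new a b d w); auto; lia. }
  destruct (st_hor a b) as [p [Hpa [Hpb Lp]]]; auto; try lia.
  destruct (missing_parent b (g w) p) as [Ep Np]; auto; try lia.
  destruct (classic (f p = f d)) as [E|Epd].
  { rewrite E in Np. contradiction. }
  destruct (classic (adj (f p) (f d))) as [E|Npd].
  { apply (sq_outward_new p b d w); auto; try lia.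
    apply (st_tri a); auto using st_sym. }
  destruct (ltc (f p) (f d) (g w) (f a) (f b)) as [x [Xp [Xd Xw]]]; auto using st_hom.
  destruct (st_surj p x) as [X [HpX EX]]; auto using adj_sym; try lia.
  subst x.
  assert (MX : M w X) by (apply (sq_outward_new p b X w); auto; lia).
  assert (HXd : A X d) by (apply (st_sq p a d X); auto).
  apply (tri_old_new X d w); auto.
Qed.

Lemma ext_sq (a b c d : S0 + W) : ext_lvl a < S n -> ext_lvl b < S n -> ext_adj a b ->
  ext_adj a d -> ext_adj b c -> adj (ext_f d) (ext_f c) -> ext_adj d c.
Proof.
  destruct a as [a|wa]; simpl; [|lia]. destruct b as [b|wb]; simpl; [|lia].
  intros La Lb Hab Had Hbc Adc.
  destruct d as [d|w1], c as [c|w2]; simpl in *.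
  - apply (st_sq a b c d); auto.
  - apply (sq_new a b d w2); auto.
  - apply (sq_new b a c w1); auto using st_sym, adj_sym.
  - split; auto.
    destruct (st_hor a b) as [p [Hpa [Hpb Lp]]]; auto.
    { rewrite (M_lvl _ _ Had), (M_lvl _ _ Hbc); auto. }
    rewrite (M_lvl _ _ Had) in Lp.
    apply (new_corner w1 w2 p a b); auto.
Qed.

Definition extension : stage G v0 (S n).
Proof.
  refine (Stage G v0 (S n) (S0 + W) ext_lvl ext_f ext_adj (inl st_root)
    ext_sym _ _ _ _ _ _ ext_inj ext_tri _ ext_sq _ _).
  - intros [x|w] [y|w']; simpl.
    + apply st_hom.
    + apply M_adj.
    + intro; apply adj_sym; auto.
    + tauto.
  - intros [x|w]; simpl; auto. apply Nat.le_le_succ_r, st_lvl_le.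
  - intros [x|w] [y|w']; simpl; intro H.
    + apply st_lvl_adj; auto.
    + rewrite (M_lvl _ _ H); auto.
    + rewrite (M_lvl _ _ H); auto.
    + auto.
  - intros [x|w]; simpl; split; intro H.
    + f_equal. apply st_root_lvl; auto.
    + inversion H. apply st_root_lvl; auto.
    + discriminate.
    + discriminate.
  - apply st_root_f.
  - intros [x|w] k; simpl; intro H.
    + destruct (st_parent x k H) as [p [? ?]]. exists (inl p); auto.
    + destruct (M_ex w) as [q Mq]. exists (inl q). simpl. rewrite (M_lvl _ _ Mq).
      split; auto; lia.
  (* A neighbour without a lift in the old ball is missing at [x], so a new vertex lies over it. *)
  - intros [x|w] y; simpl; intros L Axy; [|lia].
    destruct (classic (exists z, A x z /\ f z = y)) as [[z [? ?]]|N].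
    { exists (inl z); auto. }
    assert (Lx : lvl x = n).
    { pose proof (st_lvl_le x). destruct (Nat.eq_dec (lvl x) n); auto.
      exfalso; apply N, st_surj; auto; lia. }
    destruct (M_lift y x) as [w [E Mw]].
    { repeat split; auto. simpl. intros z Hz Ez. eauto. }
    exists (inr w); auto.
  - intros [y|w] [p|w1] [p'|w2]; simpl; intros H1 H2 L1 L2 N;
      try (pose proof (st_lvl_le y)); try lia.
    + destruct (st_par y p p') as [c [? [? ?]]]; auto; [congruence|].
      exists (inl c); auto.
    + destruct (M_sib w p p' H1 H2) as [->|[c [? [? Lc]]]]; [congruence|].
      exists (inl c). simpl. repeat split; auto. lia.
  - intros [x|w] [y|w']; simpl; intros H L.
    + destruct (st_hor x y) as [c [? [? ?]]]; auto. exists (inl c); auto.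
    + pose proof (st_lvl_le x). lia.
    + pose proof (st_lvl_le y). lia.
    + destruct H as [_ [q [Mq Mq']]]. exists (inl q). simpl.
      rewrite (M_lvl _ _ Mq). auto.
Defined.

End Extension.

Lemma stage_succ : inhabited (stage G v0 (S n)).
Proof.
  destruct (quotient (S0 * G) missing same_lift) as [W [rep [R1 [R2 R3]]]].
  - intros a _. split; [reflexivity|left; reflexivity].
  - intros a b [E S]. split; auto using siblings_sym.
  - apply same_lift_trans.
  - constructor. apply (extension W rep); auto.
Qed.

End Step.

Lemma stage_exists n : inhabited (stage G v0 n).
Proof.
  induction n as [|n [S0]]; [apply stage_zero|apply (stage_succ n S0)].
Qed.

End Cover.

(** * Walks as lists *)

Section ListWalk.
Context (G : graph).
Implicit Types (u v w x y z : G) (l m k : list G).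

Inductive list_walk : G -> list G -> G -> Prop :=
| list_walk_nil : forall u, list_walk u [] u
| list_walk_cons : forall u w l v, adj u w -> list_walk w l v -> list_walk u (w :: l) v.

(** The reversed walk without its starting vertex, in keeping with [list_walk u l v], where [l]
    omits [u]. *)
Fixpoint backwards u l : list G :=
  match l with [] => [] | w :: l' => backwards w l' ++ [u] end.

Lemma list_walk_app u l v m w : list_walk u l v -> list_walk v m w -> list_walk u (l ++ m) w.
Proof. induction 1; simpl; intros; auto. constructor; auto. Qed.

Lemma list_walk_backwards u l v : list_walk u l v -> list_walk v (backwards u l) u.
Proof.
  induction 1 as [u|u w l v A W IH]; simpl; [constructor|].
  eapply list_walk_app; eauto. constructor; [apply adj_sym; auto|constructor].
Qed.

Lemma list_walk_is_walk u l v : list_walk u l v -> is_walk G (u :: l).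
Proof. induction 1; simpl; auto. Qed.

Lemma list_walk_last u l v : list_walk u l v -> (l = [] /\ u = v) \/ exists l', l = l' ++ [v].
Proof.
  induction 1 as [u|u w l v A W [[-> ->]|[l' ->]]]; auto; right.
  - exists []; auto.
  - exists (w :: l'); auto.
Qed.

Lemma list_walk_of_walkn u v n : walkn G u v n -> exists l, list_walk u l v /\ length l = n.
Proof.
  induction 1 as [u|u w v n A W [l [L E]]].
  - exists []. split; [constructor|auto].
  - exists (w :: l). split; [constructor; auto|simpl; auto].
Qed.

Lemma closed_list_walk_homotopic u l :
  triangle_simply_connected G -> list_walk u l u -> homotopic G (u :: l) [u].
Proof.
  intros SC L. destruct (list_walk_last u l u L) as [[-> _]|[l' ->]].
  - apply homotopic_refl.
  - apply SC. eapply list_walk_is_walk; eauto.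
Qed.

End ListWalk.
Arguments list_walk {G}.
Arguments backwards {G}.

(** * Lifting homotopies to the balls *)

Section Lifting.
Context (G : graph) (v0 : G).

Section InStage.
Context (n : nat) (S0 : stage G v0 n).
Implicit Types (p q r s t : S0) (l m k : list G).

Inductive lift : S0 -> list G -> S0 -> Prop :=
| lift_nil : forall p, lift p [] p
| lift_cons : forall p q l r, st_adj p q -> lift q l r -> lift p (st_f q :: l) r.

Lemma lift_app p l m r : lift p (l ++ m) r <-> exists q, lift p l q /\ lift q m r.
Proof.
  split.
  - revert p. induction l as [|x l IH]; simpl; intros p L.
    + exists p. split; [constructor|auto].
    + inversion L as [|? s ? ? As Ls]; subst. destruct (IH s Ls) as [q' [L1 L2]].
      exists q'. split; auto. constructor; auto.
  - intros [q [L1 L2]]. induction L1; simpl; auto. constructor; auto.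
Qed.

Lemma lift_fun p l q r : lift p l q -> lift p l r -> q = r.
Proof.
  intro L. revert r. induction L as [p|p p' l q A L IH]; intros r L2.
  - inversion L2; auto.
  - inversion L2 as [|? s ? ? As Ls Es]; subst. rewrite (st_inj p s p') in Ls; auto.
Qed.

Lemma lift_end_inj p q l r : lift p l r -> lift q l r -> st_f p = st_f q -> p = q.
Proof.
  intro L. revert q. induction L as [p|p p' l r A L IH]; intros q L2 E.
  - inversion L2; auto.
  - inversion L2 as [|? s ? ? As Ls Es]; subst.
    assert (p' = s) by (apply IH; auto). subst s.
    apply (st_inj p'); auto using st_sym.
Qed.

Lemma lift_lvl p l q : lift p l q -> st_lvl q <= st_lvl p + length l.
Proof.
  induction 1; simpl; [lia|]. pose proof (st_lvl_adj _ _ H). lia.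
Qed.

Lemma lift_exists p l v : list_walk (st_f p) l v -> st_lvl p + length l <= n ->
  exists q, lift p l q /\ st_f q = v.
Proof.
  remember (st_f p) as u eqn:Eu. intro L. revert p Eu.
  induction L as [u|u w l v A L IH]; intros p Eu B; simpl in B.
  - exists p. split; [constructor|auto].
  - subst u. destruct (st_surj p w) as [q [Aq Eq]]; auto; try lia.
    pose proof (st_lvl_adj _ _ Aq).
    destruct (IH q) as [r [Lr Er]]; auto; try lia.
    exists r. split; auto. rewrite <- Eq. constructor; auto.
Qed.

Lemma lift_backwards p l q : lift p l q -> lift q (backwards (st_f p) l) p.
Proof.
  induction 1 as [p|p q l r A L IH]; simpl; [constructor|].
  apply lift_app. exists q. split; auto.
  constructor; [apply st_sym; auto|constructor].
Qed.

(** Homotopies act on lists that contain their first vertex, while [lift] omits it. Here this vertex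
    must be [v0], and it is lifted to the root. *)
Definition based_lift (l : list G) q : Prop :=
  match l with [] => False | x :: l' => x = v0 /\ lift st_root l' q end.

Lemma based_lift_app l x m q :
  based_lift (l ++ x :: m) q <-> exists p, based_lift (l ++ [x]) p /\ lift p m q.
Proof.
  destruct l as [|y l]; simpl.
  - split.
    + intros [E L]. exists st_root. repeat split; auto. constructor.
    + intros [p [[E L] L']]. inversion L; subst. auto.
  - split.
    + intros [E L]. change (x :: m) with ([x] ++ m) in L. rewrite app_assoc in L.
      apply lift_app in L. destruct L as [p [L1 L2]]. eauto.
    + intros [p [[E L1] L2]]. split; auto.
      change (x :: m) with ([x] ++ m). rewrite app_assoc. apply lift_app. eauto.
Qed.

Lemma based_lift_end l x p : based_lift (l ++ [x]) p -> st_f p = x /\ st_lvl p <= length l.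
Proof.
  assert (R0 : st_lvl (@st_root G v0 n S0) = 0) by (apply st_root_lvl; auto).
  destruct l as [|y l]; simpl.
  - intros [-> L]. inversion L; subst. rewrite st_root_f. split; auto. lia.
  - intros [-> L]. apply lift_app in L. destruct L as [q [L1 L2]].
    inversion L2 as [|? s ? ? As Ls]; subst. inversion Ls; subst. split; auto.
    pose proof (lift_lvl _ _ _ L1). pose proof (st_lvl_adj _ _ As). lia.
Qed.

(** The bound on the lengths keeps the place of the move below level [n], where the inserted vertex
    [y] has a lift. *)
Lemma based_lift_move l m q : elem_move G l m -> length l <= n -> length m <= n ->
  based_lift l q <-> based_lift m q.
Proof.
  intros [[l1 [l2 [x [y [A [-> ->]]]]]]|[l1 [l2 [x [y [z [A [B [C [-> ->]]]]]]]]]] L1 L2;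
    rewrite length_app in L1, L2; simpl in L1, L2.
  - rewrite (based_lift_app l1 x l2), (based_lift_app l1 x (y :: x :: l2)).
    split; intros [p [BL L]]; exists p; (split; [exact BL|]);
      destruct (based_lift_end _ _ _ BL) as [Ep Lp]; subst x.
    + destruct (st_surj p y) as [r [Ar Er]]; auto; try lia. subst y.
      constructor; auto. constructor; auto using st_sym.
    + inversion L as [|? r ? ? Ar Lr]; subst. inversion Lr as [|? t ? ? At Lt Et]; subst.
      rewrite (st_inj r p t); auto using st_sym.
  - rewrite (based_lift_app l1 x (z :: l2)), (based_lift_app l1 x (y :: z :: l2)).
    split; intros [p [BL L]]; exists p; (split; [exact BL|]);
      destruct (based_lift_end _ _ _ BL) as [Ep Lp]; subst x.
    + inversion L as [|? t ? ? At Lt]; subst.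
      destruct (st_surj p y) as [r [Ar Er]]; auto; try lia. subst y.
      constructor; auto. constructor; auto. apply (st_tri p); auto.
    + inversion L as [|? r ? ? Ar Lr]; subst. inversion Lr as [|? t ? ? At Lt Et]; subst.
      destruct (st_surj p (st_f t)) as [t' [At' Et']]; auto; try lia.
      assert (st_adj r t') by (apply (st_tri p); auto; rewrite Et'; auto).
      assert (t' = t) by (apply (st_inj r); auto). subst t'. constructor; auto.
Qed.

Lemma dist_st_f (HG : connected G) p : dist G v0 (st_f p) <= st_lvl p.
Proof.
  remember (st_lvl p) as k eqn:E. revert p E. induction k as [|k IH]; intros p E.
  - symmetry in E. apply st_root_lvl in E. subst. rewrite st_root_f, dist_refl; auto.
  - destruct (st_parent p k) as [q [A Lq]]; auto.
    pose proof (IH q (eq_sym Lq)). pose proof (dist_adj G HG v0 _ _ (st_hom _ _ A)). lia.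
Qed.

(** The level lies between the distance from [v0] and the length of the lifted walk. *)
Lemma lift_geodesic_lvl (HG : connected G) l p :
  lift st_root l p -> length l = dist G v0 (st_f p) -> st_lvl p = dist G v0 (st_f p).
Proof.
  intros L E. pose proof (lift_lvl _ _ _ L). pose proof (dist_st_f HG p).
  assert (R0 : st_lvl (@st_root G v0 n S0) = 0) by (apply st_root_lvl; auto). lia.
Qed.

End InStage.
Arguments lift {n S0}.
Arguments based_lift {n S0}.

(** A homotopy passes through finitely many lists; [N] bounds their lengths and does not depend on
    the ball. *)
Lemma based_lift_homotopic l m : homotopic G l m ->
  exists N, forall n (S0 : stage G v0 n) (q : S0), N <= n -> based_lift l q <-> based_lift m q.
Proof.
  induction 1 as [l m M|l|l m _ [N H]|l m k _ [N1 H1] _ [N2 H2]].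
  - exists (length l + length m). intros. apply based_lift_move; auto; lia.
  - exists 0. tauto.
  - exists N. intros. symmetry. auto.
  - exists (N1 + N2). intros. rewrite H1, H2 by lia. tauto.
Qed.

(** The walk along [l] and back along [m] is null-homotopic, so in a large ball its lift closes up
    at the root. The part of it over the reversed [m] and the reversed lift of [m] have the same
    end, hence the same start. *)
Lemma lift_same_end (SC : triangle_simply_connected G) l m v :
  list_walk v0 l v -> list_walk v0 m v ->
  exists N, forall n (S0 : stage G v0 n) (p q : S0), N <= n ->
    lift st_root l p -> lift st_root m q -> p = q.
Proof.
  intros Ll Lm.
  assert (C : list_walk v0 (l ++ backwards v0 m) v0).
  { eapply list_walk_app; eauto using list_walk_backwards. }
  destruct (based_lift_homotopic _ _ (closed_list_walk_homotopic G v0 _ SC C)) as [N H].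
  exists (N + length (l ++ backwards v0 m)). intros n S0 p q B Lp Lq.
  assert (R0 : st_lvl (@st_root G v0 n S0) = 0) by (apply st_root_lvl; auto).
  destruct (lift_exists n S0 st_root (l ++ backwards v0 m) v0) as [r [Lr Er]].
  { rewrite st_root_f; auto. }
  { lia. }
  assert (Br : based_lift [v0] r).
  { apply (H n S0 r); [lia|]. simpl. auto. }
  simpl in Br. destruct Br as [_ Br]. inversion Br; subst.
  apply lift_app in Lr. destruct Lr as [p' [Lp' Lb]].
  assert (p' = p) by (eapply lift_fun; eauto). subst p'.
  pose proof (lift_backwards _ _ _ _ _ Lq) as Lb'. rewrite st_root_f in Lb'.
  apply (lift_end_inj n S0 p q (backwards v0 m) st_root); auto.
  destruct (lift_exists n S0 st_root l v) as [p' [Lp2 Ep]].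
  { rewrite st_root_f; auto. }
  { rewrite length_app in B; lia. }
  destruct (lift_exists n S0 st_root m v) as [q' [Lq2 Eq]].
  { rewrite st_root_f; auto. }
  { rewrite length_app in B.
    assert (E : forall (u : G) k, length (backwards u k) = length k).
    { intros u k. revert u. induction k; simpl; intros; auto.
      rewrite length_app, IHk. simpl; lia. }
    rewrite E in B. lia. }
  rewrite (lift_fun _ _ _ _ _ _ Lp Lp2), (lift_fun _ _ _ _ _ _ Lq Lq2). congruence.
Qed.

End Lifting.

(** * From the local conditions to TC and QC *)

Section LocalToGlobal.
Context (G : graph) (HG : connected G).
Context (LTC : local_triangle_condition G) (LQC : local_quadrangle_condition G).
Context (noK : ~ has_induced K23 G).
Context (SC : triangle_simply_connected G).
Implicit Types u v w z : G.

Lemma geodesic_list u v : exists l, list_walk u l v /\ length l = dist G u v.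
Proof. apply list_walk_of_walkn, dist_walk; auto. Qed.

Lemma common_neighbor_below u n (S0 : stage G u n) (c p q : S0) :
  st_adj c p -> st_adj c q -> S (st_lvl c) = dist G u (st_f p) ->
  exists x, adj x (st_f p) /\ adj x (st_f q) /\ dist G u x = dist G u (st_f p) - 1.
Proof.
  intros Hp Hq E. exists (st_f c). repeat split; auto using st_hom.
  pose proof (dist_st_f G u n S0 HG c).
  pose proof (dist_adj G HG u _ _ (st_hom _ _ Hp)). lia.
Qed.

(** In a large ball the geodesics to [v] and [w] lift to walks with adjacent ends on the same level,
    where [st_hor] applies. *)
Lemma simply_connected_triangle : triangle_condition G.
Proof.
  intros u v w A Dv E.
  destruct (geodesic_list u v) as [l [Ll El]]. destruct (geodesic_list u w) as [m [Lm Em]].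
  assert (Lw : list_walk u (l ++ [w]) w).
  { eapply list_walk_app; eauto. constructor; [exact A|constructor]. }
  destruct (lift_same_end G u SC (l ++ [w]) m w Lw Lm) as [N H].
  set (n := N + S (length l) + length m).
  destruct (stage_exists G HG LTC LQC noK u n) as [S0].
  assert (R0 : st_lvl (@st_root G u n S0) = 0) by (apply st_root_lvl; auto).
  pose proof (@st_root_f G u n S0) as Rf.
  destruct (lift_exists G u n S0 st_root l v) as [p [Lp Fp]];
    [rewrite Rf; auto|lia|].
  destruct (lift_exists G u n S0 st_root m w) as [q [Lq Fq]];
    [rewrite Rf; auto|lia|].
  pose proof (lift_lvl _ _ _ _ _ _ _ Lp).
  destruct (st_surj p w) as [q' [Aq Fq']]; [lia|rewrite Fp; auto|].
  (* Both are ends of lifts of walks from [u] to [w], which [H] identifies. *)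
  assert (q' = q).
  { apply (H n S0); auto; [lia|]. apply lift_app. exists p. split; auto.
    rewrite <- Fq'. constructor; auto. constructor. }
  subst q'.
  assert (Lvp : st_lvl p = dist G u v).
  { rewrite <- Fp. apply (lift_geodesic_lvl G u n S0 HG l); auto. congruence. }
  assert (Lvq : st_lvl q = dist G u w).
  { rewrite <- Fq. apply (lift_geodesic_lvl G u n S0 HG m); auto. congruence. }
  destruct (st_hor p q) as [c [Cp [Cq Lc]]]; auto; try lia.
  rewrite <- Fp, <- Fq. apply (common_neighbor_below u n S0 c p q); auto. rewrite Fp; lia.
Qed.

Lemma simply_connected_quadrangle : quadrangle_condition G.
Proof.
  intros u v w z Av Aw Dvw Dv E Ez.
  destruct (geodesic_list u v) as [l [Ll El]]. destruct (geodesic_list u w) as [m [Lm Em]].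
  assert (Lw : list_walk u (l ++ [z; w]) w).
  { eapply list_walk_app; eauto. constructor; [exact Av|].
    constructor; [apply adj_sym; exact Aw|constructor]. }
  destruct (lift_same_end G u SC (l ++ [z; w]) m w Lw Lm) as [N H].
  set (n := N + S (S (length l)) + length m).
  destruct (stage_exists G HG LTC LQC noK u n) as [S0].
  assert (R0 : st_lvl (@st_root G u n S0) = 0) by (apply st_root_lvl; auto).
  pose proof (@st_root_f G u n S0) as Rf.
  destruct (lift_exists G u n S0 st_root l v) as [p [Lp Fp]];
    [rewrite Rf; auto|lia|].
  destruct (lift_exists G u n S0 st_root m w) as [q [Lq Fq]];
    [rewrite Rf; auto|lia|].
  pose proof (lift_lvl _ _ _ _ _ _ _ Lp).
  destruct (st_surj p z) as [r [Ar Fr]]; [lia|rewrite Fp; auto|].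
  pose proof (st_lvl_adj _ _ Ar).
  destruct (st_surj r w) as [q' [Aq Fq']]; [lia|rewrite Fr; apply adj_sym; auto|].
  assert (q' = q).
  { apply (H n S0); auto; [lia|]. apply lift_app. exists p. split; auto.
    rewrite <- Fq', <- Fr. constructor; auto. constructor; auto. constructor. }
  subst q'.
  assert (Lvp : st_lvl p = dist G u v).
  { rewrite <- Fp. apply (lift_geodesic_lvl G u n S0 HG l); auto. congruence. }
  assert (Lvq : st_lvl q = dist G u w).
  { rewrite <- Fq. apply (lift_geodesic_lvl G u n S0 HG m); auto. congruence. }
  (* The level of [r] is at least [dist G u z], so [r] is one level above [p] and [q] and [st_par]
     applies. *)
  pose proof (dist_st_f G u n S0 HG r) as Dr. rewrite Fr in Dr.
  destruct (st_par r p q) as [c [Cp [Cq Lc]]]; auto using st_sym; try lia.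
  { intros ->. apply dist2_inv in Dvw; auto. destruct Dvw; congruence. }
  rewrite <- Fp, <- Fq. apply (common_neighbor_below u n S0 c p q); auto. rewrite Fp; lia.
Qed.

End LocalToGlobal.

(** * The cycle of implications through elementarity *)

Theorem theorem4p3 (G : graph) (HG : connected G) :
  (prime G /\ pre_median G <->
     two_connected G /\ pre_median G /\ squares_in_W4_or_M4 G) /\
  (prime G /\ pre_median G <->
     two_connected G /\ pre_median G /\ triangle_simply_connected G) /\
  (prime G /\ pre_median G <->
     two_connected G /\ locally_weakly_modular G /\
     ~ has_induced K23 G /\ ~ has_induced W4minus G /\ triangle_simply_connected G).
Proof.
  assert (PE : pre_median G -> prime G -> elementary G).
  { intros [WM [noK noW]]. apply prime_elementary; auto. }
  assert (ESq : pre_median G -> elementary G -> squares_in_W4_or_M4 G).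
  { intros PM E. apply thick_squares_in; [apply PM|].
    apply elementary_thick; auto. }
  assert (SqSC : pre_median G -> squares_in_W4_or_M4 G -> triangle_simply_connected G).
  { intros PM Sq. apply thick_simply_connected; [exact HG|apply PM|].
    apply squares_in_thick; auto. }
  assert (SCP : two_connected G -> triangle_simply_connected G -> prime G).
  { intros T SC. apply elementary_prime; auto. apply simply_connected_elementary; auto. }
  assert (LWM : pre_median G -> locally_weakly_modular G).
  { intros [WM _]. split; [apply wm_local_triangle|apply wm_local_quadrangle]; auto. }
  assert (WM : locally_weakly_modular G -> ~ has_induced K23 G ->
    triangle_simply_connected G -> weakly_modular G).
  { intros [LTC LQC] noK SC.
    split; [apply simply_connected_triangle|apply simply_connected_quadrangle]; auto. }
  assert (TC : elementary G -> two_connected G) by (apply elementary_two_connected; auto).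
  split; [|split]; split.
  - intros [P PM]. auto.
  - intros [T [PM Sq]]. auto.
  - intros [P PM]. auto 8.
  - intros [T [PM SC]]. auto.
  - intros [P PM]. split; [auto|]. split; [auto|]. destruct PM as [WM' [noK noW]].
    assert (PM : pre_median G) by (repeat split; apply WM' || assumption). auto 8.
  - intros [T [L [noK [noW SC]]]]. split; [auto|]. split; auto.
Qed.
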